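(* Let $J\subseteq\Pi$ and let $W'$ be a subgroup of $W$ containing $W_J$. Then the following conditions are equivalent: (i) The index $[W':W_J]$ of $W_J$ in $W'$ is finite. (ii) There is a parabolic subgroup $U\supseteq W'$ of $W$ such that $[U:W_J]$ is finite. (iii) There exist $w\in W$ and $K\subseteq\Pi$ such that $L:=wJ\subseteq K$, $[W_K:W_L]$ is finite and $W_L=wW_Jw^{-1}\subseteq wW'w^{-1}\subseteq W_K$. If (i)–(iii) hold, then there is a unique inclusion-minimal element $U_0$ of the set of parabolic subgroups $U$ which satisfy (ii). If, further, $W'$ is a reflection subgroup, then $\operatorname{corank}_{U_0}(W_J)=\operatorname{corank}_{W'}(W_J)$.
   Context: $\operatorname{cone}(X)$ is the set of finite non-negative linear combinations of elements of $X$ (including $0$). $(V,B)$ is a real vector space with a symmetric bilinear form; for $B(\alpha,\alpha)\neq 0$, $s_\alpha(v)=v-\frac{2B(v,\alpha)}{B(\alpha,\alpha)}\alpha$. $(\Phi,\Pi)$ is a based root system in $(V,B)$ with associated Coxeter system $(W,S)$: $\Pi\subseteq V$; $\operatorname{cone}(\Pi)\cap\operatorname{cone}(-\Pi)=\{0\}$; for all $\alpha\in\Pi$, $\alpha\notin\operatorname{cone}(\Pi\setminus\{\alpha\})$ and $B(\alpha,\alpha)=1$; $S=\{s_\alpha\mid\alpha\in\Pi\}$, $W=\langle S\rangle$; $\Phi=\{w\alpha\mid w\in W,\alpha\in\Pi\}$ satisfies $\Phi=\Phi^+\cup\Phi^-$ where $\Phi^{\pm}=\Phi\cap\operatorname{cone}(\pm\Pi)$.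 The rank $|S|$ may be infinite. $T=\{s_\alpha\mid\alpha\in\Phi\}$ is the set of reflections. For $J\subseteq\Pi$, $W_J=\langle s_\alpha\mid\alpha\in J\rangle$ (standard parabolic subgroup); parabolic subgroups are the $W$-conjugates of standard parabolic subgroups. A reflection subgroup is a subgroup $U=\langle U\cap T\rangle$ of $W$. For reflection subgroups $U'\subseteq U$ of $W$, $\operatorname{corank}_U(U')$ is the minimum cardinality of a subset $T'\subseteq U\cap T$ such that $U=\langle(U'\cap T)\cup T'\rangle$. *)

(* Defs.v *)
From HB Require Import structures.
From mathcomp Require Import all_boot all_order all_algebra.
From mathcomp Require Import boolp classical_sets functions cardinality reals.

Set Implicit Arguments.
Unset Strict Implicit.
Unset Printing Implicit Defensive.

Import Order.TTheory GRing.Theory Num.Theory.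
Local Open Scope classical_set_scope.
Local Open Scope card_scope.
Local Open Scope ring_scope.

(* Groups of transformations of a type V are represented by the sets of their
   underlying functions V -> V, with composition as group law. *)
Section TransformationGroups.
Variable V : Type.
Implicit Types (X G H U : set (V -> V)) (w : V -> V).

Definition is_group G : Prop :=
  [/\ G id,
      forall f g, G f -> G g -> G (f \o g)
    & forall f, G f -> exists g, [/\ G g, cancel f g & cancel g f]].

(* Only meaningful when X consists of bijections: otherwise no group of
   transformations contains X, and generated X = setT. *)
Definition generated X : set (V -> V) := smallest is_group X.

(* w G w^-1, for w a bijection: h \o w = w \o g means h = w g w^-1. *)
Definition conjugate w G : set (V -> V) :=
  [set h : V -> V | exists2 g, G g & h \o w = w \o g].

Definition left_cosets G H : set (set (V -> V)) :=
  [set [set w \o h | h in H] | w in G].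

Definition finite_index G H : Prop := finite_set (left_cosets G H).

Definition inclusion_minimal (F : set (set (V -> V))) U : Prop :=
  F U /\ forall U', F U' -> U' `<=` U -> U' = U.

End TransformationGroups.

Section BasedRootSystems.
Variables (R : realType) (V : lmodType R).
Implicit Types (X J Pi : set V) (B : {symmetric V}).

Definition cone X : set V :=
  [set v | exists (n : nat) (c : 'I_n -> R) (x : 'I_n -> V),
     (forall i, 0 <= c i /\ X (x i)) /\ v = \sum_(i < n) c i *: x i].

Definition neg X : set V := [set - x | x in X].

Definition reflection B (a : V) : V -> V :=
  fun v => v - (2 * B v a / B a a) *: a.

Definition standard_parabolic B J : set (V -> V) :=
  generated [set reflection B a | a in J].

Definition weyl_group B Pi : set (V -> V) := standard_parabolic B Pi.

Definition root_system B Pi : set V :=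
  [set v | exists w a, [/\ weyl_group B Pi w, Pi a & v = w a]].

Definition is_based_root_system B Pi : Prop :=
  [/\ cone Pi `&` cone (neg Pi) = [set 0],
      forall a, Pi a -> ~ cone (Pi `\ a) a /\ B a a = 1
    & root_system B Pi =
        (root_system B Pi `&` cone Pi) `|` (root_system B Pi `&` cone (neg Pi))].

Definition reflections B Pi : set (V -> V) :=
  [set reflection B a | a in root_system B Pi].

Definition is_subgroup_of_W B Pi (U : set (V -> V)) : Prop :=
  is_group U /\ U `<=` weyl_group B Pi.

Definition is_parabolic B Pi (U : set (V -> V)) : Prop :=
  exists w K, [/\ weyl_group B Pi w, K `<=` Pi
                & U = conjugate w (standard_parabolic B K)].

Definition is_reflection_subgroup B Pi (U : set (V -> V)) : Prop :=
  is_subgroup_of_W B Pi U /\ U = generated (U `&` reflections B Pi).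

Definition corank_generators B Pi (U U' T' : set (V -> V)) : Prop :=
  T' `<=` U `&` reflections B Pi /\
  U = generated ((U' `&` reflections B Pi) `|` T').

(* corank_U(U') is a possibly infinite cardinal; it is expressed here as the
   relation "corank_U(U') is the cardinality of the set C". *)
Definition has_corank B Pi (U U' C : set (V -> V)) : Prop :=
  exists T', [/\ corank_generators B Pi U U' T',
                 forall T'', corank_generators B Pi U U' T'' -> T' #<= T''
               & T' #= C].

Definition finite_parabolic_overgroup B Pi J (W' U : set (V -> V)) : Prop :=
  [/\ is_parabolic B Pi U, W' `<=` U
    & finite_index U (standard_parabolic B J)].

End BasedRootSystems.

(* Main.v *)
Require Import Defs.
From HB Require Import structures.
From mathcomp Require Import all_boot all_order all_algebra.
From mathcomp Require Import zify ring lra.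
From mathcomp Require Import boolp classical_sets functions cardinality reals.

Set Implicit Arguments.
Unset Strict Implicit.
Unset Printing Implicit Defensive.

Import Order.TTheory GRing.Theory Num.Theory.
Local Open Scope classical_set_scope.
Local Open Scope ring_scope.

(** Condition (iii) is (ii) transported by a conjugation: if U is conjugate to
    W_K and contains W_J, an element of minimal length in the double coset
    relating them maps J into K ([parabolic_overgroup]). Since (ii) plainly
    implies (i), the point is to produce a parabolic overgroup when the index of
    W_J in W' is finite.

    The idea is a fixed point argument in the Tits cone. Let p be a dominant
    linear function vanishing on exactly the simple roots in J; its stabiliser
    is W_J, so its W'-orbit is finite and the sum x of the orbit is fixed by W'.
    Each function in the orbit is negative on finitely many positive roots only,
    hence so is x, and x can be made dominant by an element of W; therefore its
    stabiliser U is parabolic. If x vanishes at a positive root, then either all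
    functions of the orbit vanish there or one of them is negative there. So all
    but finitely many roots of U are roots of W_J, and [U : W_J] is finite,
    because an element of U of minimal length in its coset is determined by its
    set of inversions, which avoids the roots of W_J ([stab_orbit_sum]).

    Simple roots may be linearly dependent, so a linear function with prescribed
    values on them need not exist on V. It does exist on the free module on Pi,
    on which W acts as well. This action is never built: words in the simple
    roots act on functions on V by the transposed formulas, the usual induction
    on length shows that each word maps a basis vector into the cone of the
    basis or into its opposite ([lift_sign]), and it follows that a root
    determines its lift ([lift_unique]). Linear functions on the free module
    then become the reflection-linear functions on the set of roots
    ([rlinear_ext]), and nothing else about the free module is needed.

    Intersections of parabolic subgroups are parabolic ([parabolic_inter]), so an
    overgroup of minimal index is the least one U0. Write U0 as the conjugate by
    the inverse of g of W_K, with g J contained in K. Both coranks equal the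
    finite cardinal of K minus g J.

    Lower bound: if fewer reflections generated W' (or U0) over W_J, linear
    algebra would give a non-zero function q on K, zero on g J, whose
    transport by g is fixed by that group. A function fixed by U0 vanishes at all
    its roots, so q would be zero; the same holds for a function fixed by W',
    because the orbit sum of p + eps q would then have a stabiliser not
    containing U0 ([invariant_vanish]).

    Upper bound: for U0, the conjugates of the reflections in the elements of K
    minus g J suffice. For W', among the sets of roots with p > 0 whose reflections
    generate W' over W_J, take one minimising the sum of the values of p. Its
    elements, even after moving them by W_J, are pairwise at obtuse angles, for
    otherwise reflecting one in another would decrease the sum
    ([minimal_obtuse]). The sum over the orbit of p of the squares of its
    members is a positive semidefinite form invariant under W'. For this form
    the averages of the chosen roots over their W_J-orbits are obtuse, orthogonal
    to J, and on one side of the hyperplane p = 0; so they are linearly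
    independent modulo J, and there are at most as many of them as elements of K
    minus g J ([corank_upper]). *)


(** * Words in reflections *)

Section Words.
Variables (R : realType) (V : lmodType R) (B : {symmetric V}).

Lemma bilC u v : B u v = B v u.
Proof. by rewrite hermC expr0 mul1r. Qed.

Lemma bilDl u v w : B (u + v) w = B u w + B v w.
Proof. by rewrite linearDl. Qed.

Lemma bilZl (k : R) u w : B (k *: u) w = k * B u w.
Proof. by rewrite linearZl_LR. Qed.

Lemma bilBl u v w : B (u - v) w = B u w - B v w.
Proof. by rewrite linearBl. Qed.

Lemma bilNl u w : B (- u) w = - B u w.
Proof. by rewrite -(sub0r u) bilBl linear0l sub0r. Qed.

Lemma bilBr u v w : B w (u - v) = B w u - B w v.
Proof. by rewrite ![B w _]bilC bilBl. Qed.

Lemma bilZr (k : R) u w : B w (k *: u) = k * B w u.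
Proof. by rewrite ![B w _]bilC bilZl. Qed.

Lemma bilNr u w : B w (- u) = - B w u.
Proof. by rewrite ![B w _]bilC bilNl. Qed.

(** Product, in the order of the word, of the reflections in its letters. *)
Definition wprod (s : seq V) : V -> V :=
  foldr (fun a f => reflection B a \o f) id s.

Lemma wprod_cat s t : wprod (s ++ t) = wprod s \o wprod t.
Proof. by elim: s => //= a s ->. Qed.

Lemma reflection_lin a (k : R) u v :
  reflection B a (k *: u + v) = k *: reflection B a u + reflection B a v.
Proof.
rewrite /reflection bilDl bilZl scalerBr scalerA.
rewrite addrACA -opprD -scalerDl; congr (_ - _ *: _).
by ring.
Qed.

Lemma wprod_lin s (k : R) u v :
  wprod s (k *: u + v) = k *: wprod s u + wprod s v.
Proof. by elim: s => //= a s ->; rewrite reflection_lin. Qed.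

Lemma wprodD s u v : wprod s (u + v) = wprod s u + wprod s v.
Proof. by have := wprod_lin s 1 u v; rewrite !scale1r. Qed.

Lemma wprod0 s : wprod s 0 = 0.
Proof. by have := wprod_lin s (-1) 0 0; rewrite !scaleN1r !addNr. Qed.

Lemma wprodZ s (k : R) u : wprod s (k *: u) = k *: wprod s u.
Proof. by have := wprod_lin s k u 0; rewrite wprod0 !addr0. Qed.

Lemma wprodN s u : wprod s (- u) = - wprod s u.
Proof. by rewrite -scaleN1r wprodZ scaleN1r. Qed.

Lemma wprod_sum s n (f : 'I_n -> V) :
  wprod s (\sum_i f i) = \sum_i wprod s (f i).
Proof. by elim/big_rec2: _ => [|i y1 y2 _ <-]; rewrite ?wprod0 ?wprodD. Qed.

Lemma reflection1 a v : B a a = 1 ->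
  reflection B a v = v - (2 * B v a) *: a.
Proof. by move=> a1; rewrite /reflection a1 divr1. Qed.

Lemma reflection_self a : B a a = 1 -> reflection B a a = - a.
Proof.
move=> a1; rewrite reflection1 // a1 mulr1 scaler_nat mulr2n opprD addrA.
by rewrite subrr sub0r.
Qed.

Lemma reflectionN a : reflection B (- a) = reflection B a.
Proof.
apply/funext => v; rewrite /reflection !bilNr bilNl opprK scalerN.
by rewrite mulrN mulNr scaleNr opprK.
Qed.

Lemma reflection_isom a u v : B a a = 1 ->
  B (reflection B a u) (reflection B a v) = B u v.
Proof.
move=> a1; rewrite !reflection1 // !bilBl !bilBr !bilZl !bilZr a1.
by rewrite [B a v]bilC; ring.
Qed.

Lemma reflectionK a : B a a = 1 -> involutive (reflection B a).
Proof.
move=> a1 v; rewrite !reflection1 // bilBl bilZl a1 mulr1.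
rewrite -addrA -opprD -scalerDl.
have -> : 2 * B v a + 2 * (B v a - 2 * B v a) = 0 by ring.
by rewrite scale0r subr0.
Qed.

(** All letters of the word have norm 1, so that they define involutions. *)
Definition unit_word (s : seq V) := forall a, a \in s -> B a a = 1.

Lemma unit_word_cons a s : unit_word (a :: s) <-> B a a = 1 /\ unit_word s.
Proof.
split=> [h|[a1 h] b].
  by split=> [|b bs]; apply: h; rewrite inE ?eqxx ?bs ?orbT.
by rewrite inE => /orP[/eqP->//|]; apply: h.
Qed.

Lemma wprod_isom s u v : unit_word s -> B (wprod s u) (wprod s v) = B u v.
Proof.
elim: s => //= a s IHs /unit_word_cons[a1 s1].
by rewrite reflection_isom // IHs.
Qed.

Lemma wprod_revK s : unit_word s -> cancel (wprod s) (wprod (rev s)).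
Proof.
elim: s => //= a s IHs /unit_word_cons[a1 s1] v.
by rewrite rev_cons -cats1 wprod_cat /= reflectionK // IHs.
Qed.

Lemma unit_word_rev s : unit_word s -> unit_word (rev s).
Proof. by move=> s1 a; rewrite mem_rev; apply: s1. Qed.

Lemma wprodK s : unit_word s -> cancel (wprod (rev s)) (wprod s).
Proof. by move=> s1 v; rewrite -{1}[s]revK wprod_revK //; apply: unit_word_rev. Qed.

Lemma reflection_conj s a v : unit_word s ->
  reflection B (wprod s a) (wprod s v) = wprod s (reflection B a v).
Proof.
by move=> s1; rewrite /reflection !wprod_isom // wprodD wprodN wprodZ.
Qed.

Lemma wprod_conj s a : unit_word s -> B a a = 1 ->
  reflection B (wprod s a) = wprod (s ++ a :: rev s).
Proof.
move=> s1 a1; apply/funext => v; rewrite wprod_cat /=.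
by rewrite -{1}[v](wprodK s1) reflection_conj.
Qed.

(** * The action on functions, dual to the free module on the letters *)

(** Transpose of the reflection e_v |-> e_v - 2 B(v, a) e_a of the free module
    on basis (e_v). *)
Definition dual_refl (M : lmodType R) (p : V -> M) (a : V) : V -> M :=
  fun v => p v - (2 * B v a) *: p a.

(** Transpose of the product of these reflections, in the order of the word *)
Definition dual_act (M : lmodType R) (p : V -> M) (s : seq V) : V -> M :=
  foldl (@dual_refl M) p s.

Lemma dual_act_cat (M : lmodType R) (p : V -> M) s t :
  dual_act p (s ++ t) = dual_act (dual_act p s) t.
Proof. by rewrite /dual_act foldl_cat. Qed.

Lemma dual_act_id s : unit_word s -> dual_act id s = wprod s.
Proof.
elim/last_ind: s => // s a IHs s1.
have [a1 {}s1] : B a a = 1 /\ unit_word s.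
  by split=> [|b bs]; apply: s1; rewrite mem_rcons inE ?eqxx ?bs ?orbT.
rewrite -cats1 dual_act_cat /= IHs // wprod_cat /=; apply/funext => v.
by rewrite /dual_refl /= reflection1 // wprodD wprodN wprodZ.
Qed.

Lemma dual_reflK (M : lmodType R) (p : V -> M) a : B a a = 1 ->
  dual_refl (dual_refl p a) a = p.
Proof.
move=> a1; apply/funext => v; rewrite /dual_refl a1 mulr1 scalerBr scalerA.
rewrite -scalerBl -addrA -opprD -scalerDl.
have -> : 2 * B v a + (2 * B v a - 2 * B v a * 2) = 0 by ring.
by rewrite scale0r subr0.
Qed.

Lemma dual_act_revK (M : lmodType R) (p : V -> M) s : unit_word s ->
  dual_act (dual_act p s) (rev s) = p.
Proof.
elim: s p => //= a s IHs p /unit_word_cons[a1 s1].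
by rewrite rev_cons -cats1 dual_act_cat /= IHs // dual_reflK.
Qed.

Lemma dual_act_lin (M : lmodType R) (p q : V -> M) (k : R) s v :
  dual_act (fun u => k *: p u + q u) s v = k *: dual_act p s v + dual_act q s v.
Proof.
elim: s p q => //= a s IHs p q; rewrite -IHs; congr (foldl _ _ s v).
apply/funext => u; rewrite /dual_refl scalerBr scalerDr !scalerA opprD addrACA.
by rewrite [k * (2 * _)]mulrC.
Qed.

(** Functions factoring through a linear form on V are transported by the action
    on V itself. *)
Lemma dual_act_form (M : lmodType R) (m : M) (d : V) s v : unit_word s ->
  dual_act (fun u => B u d *: m) s v = B (wprod s v) d *: m.
Proof.
elim/last_ind: s v => // s a IHs v s1.
have [a1 {}s1] : B a a = 1 /\ unit_word s.
  by split=> [|b bs]; apply: s1; rewrite mem_rcons inE ?eqxx ?bs ?orbT.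
rewrite -cats1 dual_act_cat /= wprod_cat /= /dual_refl !IHs //.
rewrite reflection1 // wprodD wprodN wprodZ bilBl bilZl scalerBl.
by rewrite scalerA.
Qed.

(** The reflection in d, applied to the image under s of the basis vector of v *)
Lemma dual_act_cons (M : lmodType R) (p : V -> M) d s v : unit_word s ->
  dual_act p (d :: s) v = dual_act p s v - (2 * B (wprod s v) d) *: p d.
Proof.
move=> s1 /=.
have -> : dual_refl p d = fun u => (- 2) *: (B u d *: p d) + p u.
  by apply/funext => u; rewrite /dual_refl scalerA addrC mulNr scaleNr.
by rewrite dual_act_lin dual_act_form // addrC scalerA mulNr scaleNr.
Qed.

(** Equality of the transformations of the free module on the letters defined
    by two words. *)
Definition lift_eq (s t : seq V) :=
  forall (M : lmodType R) (p : V -> M), dual_act p s = dual_act p t.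

Lemma lift_eq_sym s t : lift_eq s t -> lift_eq t s.
Proof. by move=> h M p; rewrite h. Qed.

Lemma lift_eq_trans t s u : lift_eq s t -> lift_eq t u -> lift_eq s u.
Proof. by move=> h h' M p; rewrite h h'. Qed.

Lemma lift_eq_cat s t s' t' :
  lift_eq s t -> lift_eq s' t' -> lift_eq (s ++ s') (t ++ t').
Proof. by move=> h h' M p; rewrite !dual_act_cat h h'. Qed.

Lemma lift_eq_square s a t : B a a = 1 -> lift_eq (s ++ [:: a, a & t]) (s ++ t).
Proof. by move=> a1 M p; rewrite !dual_act_cat /= dual_reflK. Qed.

(** If the lift of u maps the basis vector of c to that of d, it conjugates the
    lifted reflection in c to the one in d. *)
Lemma lift_eq_conj u c d : unit_word u -> B c c = 1 ->
  (forall (M : lmodType R) (p : V -> M), dual_act p u c = p d) ->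
  lift_eq (u ++ [:: c]) (d :: u).
Proof.
move=> u1 c1 h M p; apply/funext => v.
have dE : d = wprod u c by rewrite -dual_act_id // h.
rewrite dual_act_cons // dual_act_cat /= /dual_refl h; congr (_ - (2 * _) *: _).
by rewrite dE wprod_isom.
Qed.

End Words.

(** * Cones *)

Section Cones.
Variables (R : realType) (V : lmodType R).
Implicit Types X Y : set V.

Lemma cone_mem X a : X a -> cone X a.
Proof.
move=> Xa; exists 1%N, (fun=> 1), (fun=> a); split=> //.
by rewrite big_ord1 scale1r.
Qed.

Lemma cone0 X : cone X 0.
Proof.
by exists 0%N, (fun=> 1), (fun=> 0); split=> [[]//|]; rewrite big_ord0.
Qed.

(** A non-negative combination of two combinations is a combination, uniformly in
    the values assigned to the generators. *)
Lemma comb_add X n1 n2 (c1 : 'I_n1 -> R) (x1 : 'I_n1 -> V)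
    (c2 : 'I_n2 -> R) (x2 : 'I_n2 -> V) (k l : R) :
  0 <= k -> 0 <= l ->
  (forall i, 0 <= c1 i /\ X (x1 i)) -> (forall i, 0 <= c2 i /\ X (x2 i)) ->
  exists n (c : 'I_n -> R) (x : 'I_n -> V),
    (forall i, 0 <= c i /\ X (x i)) /\
    forall (M : lmodType R) (p : V -> M), \sum_i c i *: p (x i) =
      k *: (\sum_i c1 i *: p (x1 i)) + l *: (\sum_i c2 i *: p (x2 i)).
Proof.
move=> k0 l0 h1 h2; exists (n1 + n2)%N.
exists (fun i => match fintype.split i with inl j => k * c1 j | inr j => l * c2 j end).
exists (fun i => match fintype.split i with inl j => x1 j | inr j => x2 j end).
split=> [i|M p].
  by case: fintype.split => j; [case: (h1 j)|case: (h2 j)]; split; rewrite ?mulr_ge0.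
rewrite big_split_ord !scaler_sumr /=; congr (_ + _); apply: eq_bigr => i _.
  by rewrite -[lshift _ _]/(unsplit (inl i)) unsplitK scalerA.
by rewrite -[rshift _ _]/(unsplit (inr i)) unsplitK scalerA.
Qed.

Lemma cone_lin X (k l : R) u v : 0 <= k -> 0 <= l -> cone X u -> cone X v ->
  cone X (k *: u + l *: v).
Proof.
move=> k0 l0 [n1 [c1 [x1 [h1 ->]]]] [n2 [c2 [x2 [h2 ->]]]].
have [n [c [x [h e]]]] := comb_add k0 l0 h1 h2.
by exists n, c, x; split=> //; rewrite (e V id).
Qed.

Lemma coneD X u v : cone X u -> cone X v -> cone X (u + v).
Proof. by move=> hu hv; have := cone_lin ler01 ler01 hu hv; rewrite !scale1r. Qed.

Lemma coneZ X (k : R) u : 0 <= k -> cone X u -> cone X (k *: u).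
Proof.
by move=> k0 hu; have := cone_lin k0 k0 hu (cone0 X); rewrite scaler0 addr0.
Qed.

Lemma cone_sum X (I : Type) (r : seq I) (P : pred I) (f : I -> V) :
  (forall i, P i -> cone X (f i)) -> cone X (\sum_(i <- r | P i) f i).
Proof.
move=> h; elim/big_rec: _ => [|i u Pi hu]; first exact: cone0.
by apply: coneD hu; apply: h.
Qed.

Lemma cone_le X Y u : X `<=` Y -> cone X u -> cone Y u.
Proof.
move=> XY [n [c [x [h ->]]]]; exists n, c, x; split=> // i.
by case: (h i) => ? /XY.
Qed.

Lemma cone_neg X u : cone (neg X) u <-> cone X (- u).
Proof.
split=> [[n [c [x [h ->]]]]|[n [c [x [h e]]]]].
  exists n, c, (fun i => - x i); split=> [i|].
    by case: (h i) => ? [y Xy <-]; rewrite opprK.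
  by rewrite -sumrN; apply: eq_bigr => i _; rewrite scalerN.
exists n, c, (fun i => - x i); split=> [i|].
  by case: (h i) => ? ?; split=> //; exists (x i).
by rewrite -[u]opprK e -sumrN; apply: eq_bigr => i _; rewrite scalerN.
Qed.

End Cones.

Section BasedRootSystem.
Variables (R : realType) (V : lmodType R) (B : {symmetric V}) (Pi : set V).
Hypothesis Pi_based : is_based_root_system B Pi.

Local Notation W := (weyl_group B Pi).
Local Notation root := (root_system B Pi).
Local Notation pos := (cone Pi).

(** * Simple roots *)

Lemma simple_norm a : Pi a -> B a a = 1.
Proof. by case: Pi_based => _ h _ /h[]. Qed.

Lemma simple_neq0 a : Pi a -> a <> 0.
Proof.
move=> /simple_norm a1 a0; move: a1; rewrite a0 linear0l => /esym/eqP.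
by rewrite oner_eq0.
Qed.

Lemma pos_antisym u : pos u -> pos (- u) -> u = 0.
Proof.
case: Pi_based => h _ _ hu hnu.
have : (cone Pi `&` cone (neg Pi)) u by split=> //; apply/cone_neg.
by rewrite h.
Qed.

Lemma pos_sum0 u v : pos u -> pos v -> u + v = 0 -> u = 0.
Proof.
move=> hu hv /eqP; rewrite addr_eq0 => /eqP e; apply: pos_antisym => //.
by rewrite e opprK.
Qed.

Lemma pos_split a u : Pi a -> pos u ->
  exists (k : R) r, [/\ 0 <= k, cone (Pi `\ a) r & u = k *: a + r].
Proof.
move=> Pa [n [c [x [h ->]]]].
exists (\sum_(i | x i == a) c i), (\sum_(i | x i != a) c i *: x i); split.
- by apply: sumr_ge0 => i _; case: (h i).
- apply: cone_sum => i /eqP xi; case: (h i) => ? ?; apply: coneZ => //.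
  exact: cone_mem.
- rewrite (bigID (fun i => x i == a)) /= scaler_suml; congr (_ + _).
  by apply: eq_bigr => i /eqP ->.
Qed.

(** A simple root spans an extremal ray of the positive cone. *)
Lemma simple_extremal a u v : Pi a -> pos u -> pos v -> u + v = a ->
  exists2 k : R, 0 <= k & u = k *: a.
Proof.
move=> Pa /(pos_split Pa)[k [r [k0 hr ->]]] /(pos_split Pa)[l [r' [l0 hr' ->]]] e.
have sub : Pi `\ a `<=` Pi by move=> x [].
have e' : r + r' = (1 - k - l) *: a.
  rewrite -[1 - k - l]addrA -opprD scalerBl scale1r; apply/eqP.
  by rewrite eq_sym subr_eq -[X in X == _]e scalerDl addrACA addrC.
have h : cone (Pi `\ a) (r + r') by apply: coneD.
have kl : 1 - k - l <= 0.
  rewrite leNgt; apply/negP => kl.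
  case: Pi_based => _ /(_ a Pa)[] ha _ _; apply: ha.
  rewrite [X in cone _ X](_ : a = (1 - k - l)^-1 *: (r + r')); last first.
    by rewrite e' scalerA mulVf ?scale1r // gt_eqF.
  by apply: coneZ h; rewrite invr_ge0 ltW.
have rr0 : r + r' = 0.
  apply: pos_antisym; first exact: cone_le h.
  by rewrite e' -scaleNr; apply: coneZ; [rewrite oppr_ge0|apply: cone_mem].
exists k => //; rewrite (_ : r = 0) ?addr0 //.
by apply: pos_sum0 rr0; apply: cone_le sub _.
Qed.

Lemma simple_propor a b (k : R) : Pi a -> B b b = 1 -> 0 <= k -> b = k *: a -> b = a.
Proof.
move=> Pa b1 k0 e; move: b1; rewrite e bilZl bilZr simple_norm // mulr1.
move=> /eqP; rewrite -expr2 sqrf_eq1 => /orP[/eqP->|/eqP kN]; first by rewrite scale1r.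
by move: k0; rewrite kN lerNr oppr0 ler10.
Qed.

(** Consequently a simple root is only trivially a non-negative combination of
    positive unit vectors. *)
Lemma simple_comb n (c : 'I_n -> R) (x : 'I_n -> V) a : Pi a ->
  (forall i, 0 <= c i /\ pos (x i) /\ B (x i) (x i) = 1) ->
  \sum_i c i *: x i = a -> forall i, c i != 0 -> x i = a.
Proof.
move=> Pa h e i ci.
have hp j : pos (c j *: x j) by case: (h j) => ? [? ?]; apply: coneZ.
move: e; rewrite (bigD1 i) //= => /(simple_extremal Pa (hp i)).
case=> [|k k0 e]; first by apply: cone_sum => j _.
case: (h i) => ci0 [_ xi1].
apply: (@simple_propor _ _ ((c i)^-1 * k)) => //.
  by rewrite mulr_ge0 // invr_ge0.
by rewrite -scalerA -e scalerA mulVf // scale1r.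
Qed.

Lemma rank2_pos a b (x y : R) : Pi a -> Pi b -> a <> b ->
  pos (x *: a + y *: b) -> 0 <= x.
Proof.
move=> Pa Pb ab h; rewrite leNgt; apply/negP => x0.
have ha : pos (- x *: a) by apply: coneZ; [rewrite oppr_ge0 ltW|apply: cone_mem].
have e : - x *: a + (x *: a + y *: b) = y *: b by rewrite scaleNr addKr.
case: (lerP y 0) => y0.
  have hb : pos (- y *: b) by apply: coneZ; [rewrite oppr_ge0|apply: cone_mem].
  have : - x *: a = 0.
    apply: (pos_sum0 ha (coneD h hb)).
    by rewrite addrA e scaleNr subrr.
  move/eqP; rewrite scaler_eq0 oppr_eq0 lt_eqF //= => /eqP; exact: simple_neq0.
have yV : 0 <= y^-1 by rewrite invr_ge0 ltW.
have [|k k0 kE] :=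
  @simple_extremal b _ _ Pb (coneZ yV ha) (coneZ yV h).
- by rewrite -scalerDr e scalerA mulVf ?scale1r // gt_eqF.
- apply: ab; apply: (@simple_propor _ _ (y / - x * k)) => //.
  + exact: simple_norm.
  + by rewrite mulr_ge0 // divr_ge0 ?oppr_ge0 // ltW.
  + rewrite -scalerA -kE !scalerA.
    rewrite (_ : _ * _ = 1) ?scale1r //; field.
    by rewrite (gt_eqF y0) (lt_eqF x0).
Qed.

(** * Words in the simple reflections *)

(** Words with letters in K *)
Definition word (K : set V) (s : seq V) := forall a, a \in s -> K a.

Lemma word_cons K a s : word K (a :: s) <-> K a /\ word K s.
Proof.
split=> [h|[a1 h] b].
  by split=> [|b bs]; apply: h; rewrite inE ?eqxx ?bs ?orbT.
by rewrite inE => /orP[/eqP->//|]; apply: h.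
Qed.

Lemma word_cat K s t : word K (s ++ t) <-> word K s /\ word K t.
Proof.
split=> [h|[hs ht] b]; last by rewrite mem_cat => /orP[/hs|/ht].
by split=> b bs; apply: h; rewrite mem_cat bs ?orbT.
Qed.

Lemma word_rev K s : word K s -> word K (rev s).
Proof. by move=> hs b; rewrite mem_rev; apply: hs. Qed.

Lemma word_unit K s : K `<=` Pi -> word K s -> unit_word B s.
Proof. by move=> KPi hs b /hs/KPi/simple_norm. Qed.

Lemma word_unitPi s : word Pi s -> unit_word B s.
Proof. exact: word_unit. Qed.

Lemma wprod_group K : K `<=` Pi ->
  is_group [set wprod B s | s in [set s | word K s]].
Proof.
move=> KPi; split.
- by exists [::].
- by move=> _ _ [s hs <-] [t ht <-]; exists (s ++ t); rewrite ?wprod_cat //; apply/word_cat.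
- move=> _ [s hs <-]; exists (wprod B (rev s)); split.
  + by exists (rev s) => //; apply: word_rev.
  + exact/wprod_revK/(word_unit KPi).
  + exact/wprodK/(word_unit KPi).
Qed.

(** A standard parabolic subgroup consists of the products of words. *)
Lemma parabolicE K : K `<=` Pi ->
  standard_parabolic B K = [set wprod B s | s in [set s | word K s]].
Proof.
move=> KPi; apply/seteqP; split=> w.
  move=> /(_ _ _); apply; split; first exact: wprod_group.
  move=> _ [a Ka <-]; exists [:: a] => //.
  by move=> b; rewrite inE => /eqP ->.
move=> [s + <-] G [[G1 GM _] Gr]; elim: s => //= a s IHs /word_cons[Ka Ks].
by apply: (GM (reflection B a)); [apply: Gr; exists a|apply: IHs].
Qed.

Lemma weylE w : W w <-> exists2 s, word Pi s & w = wprod B s.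
Proof.
rewrite /weyl_group parabolicE //; split=> [[s hs <-]|[s hs ->]]; by exists s.
Qed.

Lemma weyl_wprod s : word Pi s -> W (wprod B s).
Proof. by move=> hs; apply/weylE; exists s. Qed.

Lemma root_wordE b : root b <-> exists s a, [/\ word Pi s, Pi a & b = wprod B s a].
Proof.
split=> [[w [a [/weylE[s hs ->] Pa ->]]]|[s [a [hs Pa ->]]]]; first by exists s, a.
by exists (wprod B s), a; split=> //; apply: weyl_wprod.
Qed.

Lemma root_wprod s b : word Pi s -> root b -> root (wprod B s b).
Proof.
move=> hs /root_wordE[t [a [ht Pa ->]]]; apply/root_wordE; exists (s ++ t), a.
by rewrite wprod_cat; split=> //; apply/word_cat.
Qed.

Lemma simple_root a : Pi a -> root a.
Proof. by move=> Pa; apply/root_wordE; exists [::], a. Qed.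

Lemma root_norm b : root b -> B b b = 1.
Proof.
move=> /root_wordE[s [a [hs Pa ->]]]; rewrite wprod_isom ?simple_norm //.
exact: word_unitPi.
Qed.

Lemma root_neq0 b : root b -> b <> 0.
Proof.
move=> /root_norm b1 b0; move: b1; rewrite b0 linear0l => /esym/eqP.
by rewrite oner_eq0.
Qed.

Lemma opp_root b : root b -> root (- b).
Proof.
move=> /root_wordE[s [a [hs Pa ->]]]; apply/root_wordE; exists (s ++ [:: a]), a; split=> //.
  by apply/word_cat; split=> // c; rewrite inE => /eqP->.
by rewrite wprod_cat /= reflection_self ?simple_norm // wprodN.
Qed.

Lemma root_sign b : root b -> pos b \/ pos (- b).
Proof.
case: Pi_based => _ _ h; rewrite {1}h => -[[_ ?]|[_ /cone_neg]]; by [left|right].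
Qed.

Lemma root_pos_neg b : root b -> pos b -> pos (- b) -> False.
Proof. by move=> hb h /(pos_antisym h); apply: root_neq0. Qed.

(** * Positivity in the free module on the simple roots *)

(** The word s sends the basis vector of a into the cone of the basis. *)
Definition lift_pos (s : seq V) (a : V) :=
  exists n (c : 'I_n -> R) (x : 'I_n -> V),
    (forall i, 0 <= c i /\ Pi (x i)) /\
    forall (M : lmodType R) (p : V -> M), dual_act B p s a = \sum_i c i *: p (x i).

Lemma lift_pos_comb s a b v u (x y : R) : 0 <= x -> 0 <= y ->
  lift_pos v a -> lift_pos v b ->
  (forall (M : lmodType R) (p : V -> M),
     dual_act B p s u = x *: dual_act B p v a + y *: dual_act B p v b) ->
  lift_pos s u.
Proof.
move=> x0 y0 [n1 [c1 [x1 [h1 e1]]]] [n2 [c2 [x2 [h2 e2]]]] e.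
have [n [c [z [h e']]]] := comb_add x0 y0 h1 h2.
by exists n, c, z; split=> // M p; rewrite e e1 e2 e'.
Qed.

Section RankTwo.
Variables a b : V.
Hypotheses (Pa : Pi a) (Pb : Pi b) (ab : a <> b).

Local Notation ab_word u := (word [set a; b] u).

Lemma word2_Pi u : ab_word u -> word Pi u.
Proof. by move=> hu c /hu[->|->]. Qed.

(** A word in a and b maps the basis vector of a into the plane of a and b, with
    coefficients that do not depend on the function. *)
Lemma rank2_coef u : ab_word u -> exists x y : R,
  forall (M : lmodType R) (p : V -> M), dual_act B p u a = x *: p a + y *: p b.
Proof.
elim: u => [_|c u IHu /word_cons[hc /IHu[x [y e]]]].
  by exists 1, 0 => M p; rewrite scale1r scale0r addr0.
have [->|->] : c = a \/ c = b by case: hc; [left|right].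
- exists (x - (x * (2 * B a a) + y * (2 * B b a))), y => M p /=.
  rewrite e /dual_refl !scalerBr !scalerA addrACA -opprD -scalerDl.
  by rewrite [in RHS]scalerBl addrAC.
- exists x, (y - (x * (2 * B a b) + y * (2 * B b b))) => M p /=.
  rewrite e /dual_refl !scalerBr !scalerA addrACA -opprD -scalerDl.
  by rewrite [in RHS]scalerBl addrA.
Qed.

Lemma rank2_sign x y : root (x *: a + y *: b) ->
  (0 <= x /\ 0 <= y) \/ (x <= 0 /\ y <= 0).
Proof.
case/root_sign => h; [left|right].
  split; first exact: rank2_pos ab h.
  by apply: (@rank2_pos b a y x) => //; [apply/nesym|rewrite addrC].
rewrite -!oppr_ge0; move: h; rewrite opprD -!scaleNr => h.
split; first exact: rank2_pos ab h.
by apply: (@rank2_pos b a (- y) (- x)) => //; [apply/nesym|rewrite addrC].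
Qed.

(** Exchange condition in the dihedral group generated by two simple
    reflections. *)
Lemma rank2_exchange u (x y : R) : ab_word u ->
  (forall (M : lmodType R) (p : V -> M), dual_act B p u a = x *: p a + y *: p b) ->
  x <= 0 -> y <= 0 ->
  exists u', [/\ ab_word u', (size u' < size u)%N & lift_eq B u' (u ++ [:: a])].
Proof.
elim: u x y => [|c u IHu] x y hu e x0 y0.
  have /= ea := e V id; exfalso; apply: (root_pos_neg (simple_root Pa)).
    exact: cone_mem.
  rewrite ea opprD -!scaleNr; apply: coneD; apply: coneZ; rewrite ?oppr_ge0 //;
    exact: cone_mem.
move/word_cons: hu => [hc hu].
have hPu := word2_Pi hu; have u1 := word_unitPi hPu.
have [x2 [y2 e2]] := rank2_coef hu.
have uE : wprod B u a = x2 *: a + y2 *: b by rewrite -dual_act_id // e2.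
have ru : root (wprod B u a) by apply: root_wprod => //; apply: simple_root.
have [[x20 y20]|[x20 y20]] : (0 <= x2 /\ 0 <= y2) \/ (x2 <= 0 /\ y2 <= 0).
- by apply: rank2_sign; rewrite -uE.
- have Pc : Pi c by case: hc => ->.
  have c1 := simple_norm Pc.
  have cuE : wprod B (c :: u) a = x *: a + y *: b.
    by rewrite -dual_act_id ?e //; apply/unit_word_cons.
  (* The positive root u a becomes negative under the reflection in c, so it
     is c. *)
  have cE : wprod B u a = c.
    apply: (@simple_propor _ _ (if c == a then x2 else y2)) => //.
    - exact: root_norm.
    - by case: ifP.
    - move: cuE; rewrite /= uE reflection1 // => cuE.
      have [?|?] : c = a \/ c = b by case: hc; [left|right].
      + subst c; rewrite eqxx; suff -> : y2 = 0 by rewrite scale0r addr0.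
        apply/le_anti; rewrite y20 andbT -oppr_ge0.
        set k := 2 * _ in cuE; apply: (@rank2_pos b a _ (- (x2 - k))) => //.
          exact/nesym.
        have -> : - y2 *: b + - (x2 - k) *: a = - x *: a + - y *: b.
          rewrite !scaleNr -!opprD -cuE; congr (- _).
          by rewrite scalerBl addrC addrAC.
        by apply: coneD; apply: coneZ; rewrite ?oppr_ge0 //; apply: cone_mem.
      + subst c; rewrite (_ : b == a = false); last by apply/eqP/nesym.
        suff -> : x2 = 0 by rewrite scale0r add0r.
        apply/le_anti; rewrite x20 andbT -oppr_ge0.
        set k := 2 * _ in cuE; apply: (@rank2_pos a b _ (- (y2 - k))) => //.
        have -> : - x2 *: a + - (y2 - k) *: b = - x *: a + - y *: b.
          rewrite !scaleNr -!opprD -cuE; congr (- _).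
          by rewrite scalerBl addrA.
        by apply: coneD; apply: coneZ; rewrite ?oppr_ge0 //; apply: cone_mem.
  exists u; split=> //.
  apply/lift_eq_sym => /=.
  apply: (@lift_eq_trans _ _ _ (c :: c :: u)); last exact: (lift_eq_square [::]).
  apply: (@lift_eq_cat _ _ _ [:: c] [:: c]) => //.
  apply: lift_eq_conj => //; first exact: simple_norm.
  move=> M p; rewrite e2; move: uE; rewrite cE => cE2.
  (* c is a or b, so its coordinates are 0 and 1. *)
  have aux (z t : R) : z *: a + t *: b = 0 -> z = 0 /\ t = 0.
    move=> zt; have h0 : pos (z *: a + t *: b) by rewrite zt; apply: cone0.
    have h1 : pos (- z *: a + - t *: b).
      by rewrite !scaleNr -opprD zt oppr0; apply: cone0.
    have p1 := rank2_pos Pa Pb ab h0; have p2 := rank2_pos Pa Pb ab h1.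
    rewrite addrC in h0; rewrite addrC in h1; have ba := nesym ab.
    have p3 := rank2_pos Pb Pa ba h0; have p4 := rank2_pos Pb Pa ba h1.
    rewrite !oppr_ge0 in p2 p4.
    by split; apply/le_anti; rewrite ?p1 ?p2 ?p3 ?p4.
  have [cc|cc] : c = a \/ c = b by case: hc; [left|right].
  + rewrite cc in cE2 *; have [|/eqP + ->] := @aux (x2 - 1) y2.
      by rewrite scalerBl scale1r addrAC -cE2 subrr.
    by rewrite subr_eq0 => /eqP->; rewrite scale1r scale0r addr0.
  + rewrite cc in cE2 *; have [|-> /eqP] := @aux x2 (y2 - 1).
      by rewrite scalerBl scale1r addrA -cE2 subrr.
    by rewrite subr_eq0 => /eqP->; rewrite scale1r scale0r add0r.
- have [u' [hu' su' eu']] := IHu _ _ hu e2 x20 y20.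
  exists (c :: u'); split=> //; first exact/word_cons.
  exact: (@lift_eq_cat _ _ _ [:: c] [:: c]).
Qed.

End RankTwo.

End BasedRootSystem.

Section Lift.
Variables (R : realType) (V : lmodType R) (B : {symmetric V}) (Pi : set V).
Hypothesis Pi_based : is_based_root_system B Pi.

Local Notation W := (weyl_group B Pi).
Local Notation root := (root_system B Pi).
Local Notation pos := (cone Pi).

Lemma word1 (K : set V) a : K a -> word K [:: a].
Proof. by move=> Ka b; rewrite inE => /eqP->. Qed.

(** The induction on length of the theory of the geometric representation: if s
    is reduced in the free module and appending a does not shorten it, then s
    sends the basis vector of a into the cone. *)
Lemma lift_pos_minimal n s a : (size s <= n)%N -> word Pi s -> Pi a ->
  (forall t, word Pi t -> lift_eq B t s -> (size s <= size t)%N) ->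
  (forall t, word Pi t -> lift_eq B t (s ++ [:: a]) -> (size s <= size t)%N) ->
  lift_pos B Pi s a.
Proof.
elim: n s a => [|n IHn] s a sn hs Pa red reda.
  move: sn; rewrite leqn0 size_eq0 => /eqP ->.
  by exists 1%N, (fun=> 1), (fun=> a); split=> // M p; rewrite big_ord1 scale1r.
case/lastP: s hs sn red reda => [|s' b] hs sn red reda.
  by exists 1%N, (fun=> 1), (fun=> a); split=> // M p; rewrite big_ord1 scale1r.
rewrite -cats1 in hs sn red reda *; set s := s' ++ [:: b] in hs sn red reda *.
have [hs' hb] : word Pi s' /\ word Pi [:: b] by apply/word_cat.
have Pb : Pi b by apply: hb; rewrite inE.
have sS : size s = (size s').+1 by rewrite size_cat addn1.
have ab : a <> b.
  move=> ab; subst b; have := reda s' hs'; rewrite sS ltnn => /(_ _)/negP; apply=> //.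
  rewrite -catA; apply: lift_eq_sym.
  by move=> M p; rewrite (@lift_eq_square _ _ _ s' a [::]) ?cats0 // (simple_norm Pi_based).
(* Factor off the longest possible right factor in the letters a and b. *)
pose fact v u := [/\ word Pi v, word [set a; b] u,
  (size v + size u)%N = size s & lift_eq B (v ++ u) s].
have exP : exists k, `[< exists v u, fact v u /\ size v = k >].
  exists (size s'); apply/asboolP; exists s', [:: b]; split=> //; split=> //.
  - by apply: word1; right.
  - by rewrite addn1.
case: (ex_minnP exP) => k /asboolP[v [u [[hv hu svu evu] <-]]] kmin.
have sv : (size v < size s)%N.
  rewrite sS ltnS; apply: kmin; apply/asboolP; exists s', [:: b]; split=> //; split=> //.
  - by apply: word1; right.
  - by rewrite addn1.
have hPu : word Pi u by apply: word2_Pi hu.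
have vred t : word Pi t -> lift_eq B t v -> (size v <= size t)%N.
  move=> ht etv; have := red (t ++ u).
  rewrite size_cat -svu leq_add2r; apply; first exact/word_cat.
  by apply: lift_eq_trans evu; apply: lift_eq_cat.
have vdesc d t : [set a; b] d -> word Pi t -> lift_eq B t (v ++ [:: d]) ->
    (size v <= size t)%N.
  move=> hd ht etv; rewrite leqNgt; apply/negP => stv.
  have hd1 : B d d = 1 by case: hd => ->; apply: (simple_norm Pi_based).
  have hdu : word [set a; b] (d :: u) by apply/word_cons.
  have e : lift_eq B (t ++ d :: u) s.
    apply: lift_eq_trans evu.
    apply: (@lift_eq_trans _ _ _ ((v ++ [:: d]) ++ d :: u)); first exact: lift_eq_cat.
    by rewrite -catA /=; apply: lift_eq_square.
  have htdu : word Pi (t ++ d :: u).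
    by apply/word_cat; split=> //; apply: (word2_Pi Pa Pb).
  have := red _ htdu e; rewrite size_cat /= => le1.
  suff : (size v <= size t)%N by rewrite leqNgt stv.
  apply: kmin; apply/asboolP; exists t, (d :: u); split=> //; split=> //=; lia.
have pa : lift_pos B Pi v a.
  apply: IHn => //; first by rewrite -ltnS (leq_trans sv).
  by move=> t ht; apply: vdesc => //; left.
have pb : lift_pos B Pi v b.
  apply: IHn => //; first by rewrite -ltnS (leq_trans sv).
  by move=> t ht; apply: vdesc => //; right.
have [x [y e]] := @rank2_coef _ _ B a b _ hu.
have [[x0 y0]|[x0 y0]] : (0 <= x /\ 0 <= y) \/ (x <= 0 /\ y <= 0).
- apply: (rank2_sign Pi_based Pa Pb ab).
  rewrite -(e V id) dual_act_id; last exact: (word_unitPi Pi_based).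
  by apply: (root_wprod Pi_based) => //; apply: simple_root Pi_based _ Pa.
- apply: (lift_pos_comb x0 y0 pa pb) => M p.
  by rewrite -evu dual_act_cat e.
- have [u' [hu' su' eu']] := rank2_exchange Pi_based Pa Pb ab hu e x0 y0.
  have := reda (v ++ u').
  have h1 : word Pi (v ++ u') by apply/word_cat; split=> //; apply: (word2_Pi Pa Pb).
  move=> /(_ h1); rewrite size_cat -svu leq_add2l leqNgt su' => /(_ _)/wrap[]//.
  apply: (@lift_eq_trans _ _ _ ((v ++ u) ++ [:: a])).
    by rewrite -catA; apply: lift_eq_cat.
  exact: lift_eq_cat.
Qed.

Lemma reduced_exists s : word Pi s -> exists s', [/\ word Pi s', lift_eq B s' s &
  forall t, word Pi t -> lift_eq B t s -> (size s' <= size t)%N].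
Proof.
move=> hs.
have exP : exists k, `[< exists t, [/\ word Pi t, lift_eq B t s & size t = k] >].
  by exists (size s); apply/asboolP; exists s.
case: (ex_minnP exP) => k /asboolP[s' [hs' e <-]] kmin.
by exists s'; split=> // t ht et; apply: kmin; apply/asboolP; exists t.
Qed.

(** Every word sends each basis vector into the cone of the basis or into its
    opposite. *)
Lemma lift_sign s a : word Pi s -> Pi a ->
  lift_pos B Pi s a \/
  exists2 t, lift_pos B Pi t a &
    forall (M : lmodType R) (p : V -> M), dual_act B p s a = - dual_act B p t a.
Proof.
move=> hs Pa.
have a1 := simple_norm Pi_based Pa.
have hsa : word Pi (s ++ [:: a]) by apply/word_cat; split=> //; apply: word1.
have [s' [hs' es' ms']] := reduced_exists hs.
have [t [ht et mt]] := reduced_exists hsa.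
have e1 : lift_eq B (s' ++ [:: a]) (s ++ [:: a]) by apply: lift_eq_cat.
have e2 : lift_eq B (t ++ [:: a]) s.
  apply: (@lift_eq_trans _ _ _ ((s ++ [:: a]) ++ [:: a])); first exact: lift_eq_cat.
  by move=> M p; rewrite -catA (@lift_eq_square _ _ _ s a [::]) ?cats0.
have [le|le] := leqP (size s') (size t).
- left; have [n [c [x [h e]]]] : lift_pos B Pi s' a.
    apply: (@lift_pos_minimal (size s')) => // [u hu eu|u hu eu].
      by apply: ms' => //; apply: lift_eq_trans es'.
    by apply: (leq_trans le); apply: mt => //; apply: lift_eq_trans e1.
  by exists n, c, x; split=> // M p; rewrite -e es'.
- right; exists t.
    apply: (@lift_pos_minimal (size t)) => // [u hu eu|u hu eu].
      by apply: mt => //; apply: lift_eq_trans et.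
    apply: (leq_trans (ltnW le)); apply: ms' => //.
    exact: lift_eq_trans e2.
  move=> M p; rewrite -e2 dual_act_cat /= /dual_refl a1 mulr1 scaler_nat mulr2n.
  by rewrite opprD addrA subrr sub0r.
Qed.

(** The vector w a determines its lift to the free module on Pi. *)
Lemma lift_unique s t a b : word Pi s -> word Pi t -> Pi a -> Pi b ->
  wprod B s a = wprod B t b ->
  forall (M : lmodType R) (p : V -> M), dual_act B p s a = dual_act B p t b.
Proof.
move=> hs ht Pa Pb e M p.
have s1 := word_unitPi Pi_based hs; have t1 := word_unitPi Pi_based ht.
have hz : word Pi (rev t ++ s) by apply/word_cat; split=> //; apply: word_rev.
have z1 := word_unitPi Pi_based hz.
suff ez : forall (M : lmodType R) (p : V -> M), dual_act B p (rev t ++ s) a = p b.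
  by rewrite -(ez M (dual_act B p t)) dual_act_cat dual_act_revK.
have zb : wprod B (rev t ++ s) a = b by rewrite wprod_cat /= e wprod_revK.
have [|[t' [n [c [x [h et']]]] e']] := lift_sign hz Pa; last first.
  have /= := e' V id; rewrite dual_act_id // zb et' => bE.
  case: (root_pos_neg Pi_based (simple_root Pi_based Pb)) => //.
    exact: cone_mem.
  by rewrite bE opprK; exists n, c, x.
move=> [n [c [x [h ez]]]] {}M {}p; rewrite ez.
have bE : \sum_i c i *: x i = b by rewrite -zb -dual_act_id // (ez V id).
have xb i : c i != 0 -> x i = b.
  apply: (simple_comb Pi_based Pb _ bE) => j; case: (h j) => c0 Px.
  split=> //; split; first exact: cone_mem.
  exact: simple_norm Pi_based _ Px.
have cx (N : lmodType R) (q : V -> N) : \sum_i c i *: q (x i) = (\sum_i c i) *: q b.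
  rewrite scaler_suml; apply: eq_bigr => i _.
  by have [->|/xb->//] := eqVneq (c i) 0; rewrite !scale0r.
rewrite cx; suff -> : \sum_i c i = 1 by rewrite scale1r.
apply/eqP; rewrite -subr_eq0; apply/eqP.
have : (\sum_i c i - 1) *: b = 0 by rewrite scalerBl scale1r -(cx V id) bE subrr.
by move/eqP; rewrite scaler_eq0 => /orP[/eqP//|/eqP/(simple_neq0 Pi_based Pb)].
Qed.

(** * Reflection-linear functions on the roots *)

(** Restrictions to the roots of the linear functions on the free module on Pi;
    the value 0 is taken outside the roots. *)
Definition rlinear (x : V -> R) :=
  (forall b, ~ root b -> x b = 0) /\
  (forall b g, root b -> root g -> x (reflection B g b) = x b - 2 * B b g * x g).

(** A reflection-linear function can be prescribed on the simple roots. *)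
Lemma rlinear_ext (q : V -> R) : exists2 x, rlinear x & forall a, Pi a -> x a = q a.
Proof.
pose p : V -> R^o := q.
pose P b (y : R) := exists s a, [/\ word Pi s, Pi a, b = wprod B s a & y = dual_act B p s a].
have xP b : exists y : R, root b /\ P b y \/ ~ root b /\ y = 0.
  have [/(root_wordE Pi_based)[s [a [hs Pa e]]]|nb] := pselect (root b).
    exists (dual_act B p s a); left; split; last by exists s, a.
    by apply/(root_wordE Pi_based); exists s, a.
  by exists 0; right.
have [x xE] := choice xP.
have xw s a : word Pi s -> Pi a -> x (wprod B s a) = dual_act B p s a.
  move=> hs Pa; have [[_ [t [b [ht Pb e ->]]]]|[nr _]] := xE (wprod B s a).
    exact: (lift_unique ht hs Pb Pa (esym e) p).
  by case: nr; apply/(root_wordE Pi_based); exists s, a.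
exists x; last by move=> a Pa; apply: (xw [::]).
split=> [b nb|b g]; first by case: (xE b) => [[/nb]|[]].
move=> /(root_wordE Pi_based)[s [a [hs Pa ->]]] /(root_wordE Pi_based)[t [c [ht Pc ->]]].
have t1 := word_unitPi Pi_based ht; have c1 := simple_norm Pi_based Pc.
have s1 := word_unitPi Pi_based hs.
have hts : word Pi (rev t ++ s) by apply/word_cat; split=> //; apply: word_rev.
have hr : word Pi ((t ++ c :: rev t) ++ s).
  apply/word_cat; split=> //; apply/word_cat; split=> //.
  by apply/word_cons; split=> //; apply: word_rev.
rewrite wprod_conj // -[_ (_ ++ _) _]/((wprod B _ \o wprod B s) a) -wprod_cat !xw //.
rewrite -catA dual_act_cat cat_cons dual_act_cons; last exact: (word_unitPi Pi_based).
rewrite dual_act_cat dual_act_revK // wprod_cat /=; congr (_ - 2 * _ * _).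
by rewrite -[in RHS](wprodK t1 (wprod B s a)) wprod_isom.
Qed.

Lemma rlinear_comp s x : word Pi s -> rlinear x -> rlinear (x \o wprod B s).
Proof.
move=> hs [x0 xr]; have s1 := word_unitPi Pi_based hs; split=> [b nb|b g hb hg] /=.
  apply: x0 => /(root_wprod Pi_based (word_rev hs)).
  by rewrite wprod_revK.
rewrite -reflection_conj // xr; try exact: root_wprod.
by rewrite wprod_isom.
Qed.

(** A reflection-linear function is determined by its values on simple roots. *)
Lemma rlinear_dual_act x s a : rlinear x -> word Pi s -> Pi a ->
  x (wprod B s a) = dual_act B (x : V -> R^o) s a.
Proof.
elim: s x a => [|c s IHs] x a //= hx /word_cons[Pc hs] Pa.
have hc : word Pi [:: c] by apply: word1.
rewrite -[LHS]/((x \o wprod B [:: c]) (wprod B s a)) IHs //; last exact: rlinear_comp.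
have : forall b, Pi b -> (x \o reflection B c) b = dual_refl B (x : V -> R^o) c b.
  move=> b Pb; case: hx => _ /=; apply; exact: simple_root.
move: (x \o reflection B c) (dual_refl _ _ _) => p q.
elim: s hs p q {IHs} => [_|d s IHs /word_cons[Pd hs]] p q h; first exact: h.
apply: IHs => // b Pb /=; rewrite /dual_refl (h b) // (h d) //.
Qed.

(** A positive root is a non-negative combination of simple roots, with the
    same coefficients on all reflection-linear functions. *)
Lemma pos_root_comb b : root b -> pos b ->
  exists n (c : 'I_n -> R) (a : 'I_n -> V),
    [/\ forall i, 0 <= c i /\ Pi (a i), b = \sum_i c i *: a i &
        forall x, rlinear x -> x b = \sum_i c i * x (a i)].
Proof.
move=> /(root_wordE Pi_based)[s [a [hs Pa ->]]] hp.
have s1 := word_unitPi Pi_based hs.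
have [[n [c [z [h e]]]]|[t [n [c [z [h et]]]] e]] := lift_sign hs Pa.
  exists n, c, z; split=> // [|x hx]; first by rewrite -dual_act_id // e.
  by rewrite rlinear_dual_act // e.
case: (root_pos_neg Pi_based _ hp).
  by apply: root_wprod => //; apply: simple_root.
by rewrite -dual_act_id // e et opprK; exists n, c, z.
Qed.

End Lift.

(** * Groups of transformations *)

Section Transformations.
Variable V : Type.
Implicit Types (G H : set (V -> V)) (w g h : V -> V).

Lemma group_id G : is_group G -> G id. Proof. by case. Qed.

Lemma group_comp G g h : is_group G -> G g -> G h -> G (g \o h).
Proof. by case=> _ h2 _; apply: h2. Qed.

Lemma group_inv G g : is_group G -> G g ->
  exists g', [/\ G g', cancel g g' & cancel g' g].
Proof. by case=> _ _; apply. Qed.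

Lemma cancel_uniq g g1 g2 : cancel g1 g -> cancel g g2 -> g1 = g2.
Proof. by move=> h1 h2; apply/funext => v; rewrite -[LHS]h2 h1. Qed.

Lemma group_inv_mem G g g' : is_group G -> G g -> cancel g g' -> cancel g' g -> G g'.
Proof.
move=> hG /(group_inv hG)[h [Gh h1 h2]] g1 g2.
by rewrite (cancel_uniq g2 h1).
Qed.

Lemma generated_group (X : set (V -> V)) (G : set (V -> V)) :
  is_group G -> X `<=` G -> is_group (generated X).
Proof.
move=> hG XG; split.
- by move=> H [[]].
- by move=> f g hf hg H hH; have [[_ HM _] _] := hH; apply: HM; [apply: hf|apply: hg].
- move=> f hf; have [f' [_ f1 f2]] := group_inv hG (hf _ (conj hG XG)).
  exists f'; split=> // H hH; have [hHg _] := hH.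
  exact: group_inv_mem hHg (hf _ hH) f1 f2.
Qed.

Lemma generated_mem (X : set (V -> V)) : X `<=` generated X.
Proof. by move=> f Xf G [_]; apply. Qed.

Lemma generated_sub (X G : set (V -> V)) :
  is_group G -> X `<=` G -> generated X `<=` G.
Proof. by move=> hG XG f; apply. Qed.

Lemma group_inter G H : is_group G -> is_group H -> is_group (G `&` H).
Proof.
move=> hG hH; split; first by split; apply: group_id.
  by move=> f g [? ?] [? ?]; split; apply: group_comp.
move=> f [Gf Hf]; have [f' [Gf' f1 f2]] := group_inv hG Gf.
by exists f'; split=> //; split=> //; apply: group_inv_mem hH Hf f1 f2.
Qed.

Lemma conjugateP w w' G h : cancel w w' -> cancel w' w ->
  conjugate w G h <-> G (w' \o h \o w).
Proof.
move=> w1 w2; split=> [[g Gg e]|Gh].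
  suff -> : w' \o h \o w = g by [].
  by rewrite -compA e compA (_ : w' \o w = id) //; apply/funext.
exists (w' \o h \o w) => //; rewrite compA.
by rewrite (_ : w \o (w' \o h) = h) //; apply/funext => v /=; rewrite w2.
Qed.

Lemma conjugate_group w w' G : cancel w w' -> cancel w' w -> is_group G ->
  is_group (conjugate w G).
Proof.
move=> w1 w2 hG; split.
- apply/(conjugateP _ _ w1 w2); rewrite (_ : _ \o w = id); first exact: group_id.
  by apply/funext.
- move=> f g /(conjugateP _ _ w1 w2) hf /(conjugateP _ _ w1 w2) hg.
  apply/(conjugateP _ _ w1 w2).
  rewrite (_ : _ \o w = (w' \o f \o w) \o (w' \o g \o w)); first exact: group_comp.
  by apply/funext => v /=; rewrite w2.
- move=> f /(conjugateP _ _ w1 w2) hf; have [f' [hf' f1 f2]] := group_inv hG hf.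
  exists (w \o f' \o w'); split.
  + apply/(conjugateP _ _ w1 w2); rewrite (_ : _ \o w = f') //.
    by apply/funext => v /=; rewrite !w1.
  + by move=> v /=; apply: (can_inj w2); rewrite w1 -{1}(w2 v); apply: f1.
  + by move=> v /=; rewrite -[RHS]w2 -[in RHS](f2 (w' v)) /= w2.
Qed.

Lemma conjugateI w w' G H : cancel w w' -> cancel w' w ->
  conjugate w (G `&` H) = conjugate w G `&` conjugate w H.
Proof.
move=> w1 w2; apply/seteqP; split=> h.
  by move=> /(conjugateP _ _ w1 w2)[? ?]; split; apply/(conjugateP _ _ w1 w2).
move=> [/(conjugateP _ _ w1 w2)? /(conjugateP _ _ w1 w2)?].
exact/(conjugateP _ _ w1 w2).
Qed.

Lemma conjugate_comp w1 w1' w2 w2' G :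
  cancel w1 w1' -> cancel w1' w1 -> cancel w2 w2' -> cancel w2' w2 ->
  conjugate w1 (conjugate w2 G) = conjugate (w1 \o w2) G.
Proof.
move=> a1 a2 b1 b2; have c1 : cancel (w1 \o w2) (w2' \o w1') by exact: can_comp.
have c2 : cancel (w2' \o w1') (w1 \o w2) by exact: can_comp.
apply/seteqP; split=> h.
  by move=> /(conjugateP _ _ a1 a2)/(conjugateP _ _ b1 b2) ?; apply/(conjugateP _ _ c1 c2).
by move=> /(conjugateP _ _ c1 c2) ?; apply/(conjugateP _ _ a1 a2)/(conjugateP _ _ b1 b2).
Qed.

Lemma conjugateK w w' G : cancel w w' -> cancel w' w ->
  conjugate w' (conjugate w G) = G.
Proof.
move=> w1 w2; rewrite (conjugate_comp _ w2 w1 w1 w2) (_ : w' \o w = id); last exact/funext.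
apply/seteqP; split=> h; first by move=> [k Gk e]; rewrite -[h]/(h \o id) e.
by exists h.
Qed.

Lemma conjugate_sub w G H : G `<=` H -> conjugate w G `<=` conjugate w H.
Proof. by move=> GH h [k /GH Hk e]; exists k. Qed.

Lemma finite_index_conj w w' G H : cancel w w' -> cancel w' w ->
  finite_index G H -> finite_index (conjugate w G) (conjugate w H).
Proof.
move=> w1 w2 fin.
apply: (sub_finite_set (B := (fun C => [set w \o c \o w' | c in C]) @` left_cosets G H)).
  move=> _ [g /(conjugateP _ _ w1 w2) Gg <-].
  exists [set (w' \o g \o w) \o h | h in H]; first by exists (w' \o g \o w).
  apply/seteqP; split=> [_ [_ [h Hh <-] <-]|_ [h /(conjugateP _ _ w1 w2) Hh <-]].
    exists (w \o h \o w'); last by apply/funext => v /=; rewrite w2.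
    apply/(conjugateP _ _ w1 w2); rewrite (_ : _ \o w = h) //.
    by apply/funext => v /=; rewrite !w1.
  exists ((w' \o g \o w) \o (w' \o h \o w)); first by exists (w' \o h \o w).
  by apply/funext => v /=; rewrite !w2.
exact: finite_image.
Qed.

Lemma conjugate_self G g : is_group G -> G g -> conjugate g G = G.
Proof.
move=> hG Gg; have [g' [Gg' g1 g2]] := group_inv hG Gg.
apply/seteqP; split=> h.
  move=> /(conjugateP _ _ g1 g2) Gh.
  have -> : h = g \o (g' \o h \o g) \o g' by apply/funext => v /=; rewrite !g2.
  exact: (group_comp hG (group_comp hG Gg Gh) Gg').
move=> Gh; apply/(conjugateP _ _ g1 g2).
exact: (group_comp hG (group_comp hG Gg' Gh) Gg).
Qed.

End Transformations.

Section Weyl.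
Variables (R : realType) (V : lmodType R) (B : {symmetric V}) (Pi : set V).
Hypothesis Pi_based : is_based_root_system B Pi.

Local Notation W := (weyl_group B Pi).
Local Notation root := (root_system B Pi).
Local Notation pos := (cone Pi).
Local Notation rlinear := (rlinear B Pi).
Local Notation parabolic K := (standard_parabolic B K).
Implicit Types (J K : set V) (w u g : V -> V) (x y : V -> R).

(** * Elements of the Weyl group *)

Lemma parabolic_group K : K `<=` Pi -> is_group (parabolic K).
Proof.
by move=> KPi; rewrite (parabolicE Pi_based KPi); exact: (wprod_group Pi_based KPi).
Qed.

Lemma weyl_is_group : is_group W.
Proof. exact: parabolic_group. Qed.

Lemma parabolic_weyl K : K `<=` Pi -> parabolic K `<=` W.
Proof.
move=> KPi; apply: generated_sub; first exact: weyl_is_group.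
by move=> _ [a Ka <-]; apply: generated_mem; exists a => //; apply: KPi.
Qed.

Lemma parabolic_mem K a : K a -> parabolic K (reflection B a).
Proof. by move=> Ka; apply: generated_mem; exists a. Qed.

Lemma weylN w (u : V) : W w -> w (- u) = - w u.
Proof. by move=> /(weylE Pi_based)[s hs ->]; apply: wprodN. Qed.

Lemma weyl_sum w n (c : 'I_n -> R) (a : 'I_n -> V) : W w ->
  w (\sum_i c i *: a i) = \sum_i c i *: w (a i).
Proof.
move=> /(weylE Pi_based)[s hs ->]; rewrite wprod_sum.
by apply: eq_bigr => i _; rewrite wprodZ.
Qed.

Lemma weyl_isom w (u v : V) : W w -> B (w u) (w v) = B u v.
Proof.
by move=> /(weylE Pi_based)[s hs ->]; apply: wprod_isom; apply: (word_unitPi Pi_based).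
Qed.

Lemma weyl_root w b : W w -> root b -> root (w b).
Proof. by move=> /(weylE Pi_based)[s hs ->]; apply: (root_wprod Pi_based). Qed.

Lemma weyl_reflection w b v : W w -> w (reflection B b v) = reflection B (w b) (w v).
Proof.
move=> /(weylE Pi_based)[s hs ->]; rewrite reflection_conj //.
exact: (word_unitPi Pi_based).
Qed.

Lemma weyl_inv w : W w -> exists w', [/\ W w', cancel w w' & cancel w' w].
Proof. exact: group_inv weyl_is_group. Qed.

Lemma weyl_comp w u : W w -> W u -> W (w \o u).
Proof. exact: group_comp weyl_is_group. Qed.

Lemma weyl_simple a : Pi a -> W (reflection B a).
Proof. exact: parabolic_mem. Qed.

Lemma weyl_refl b : root b -> W (reflection B b).
Proof.
move=> /(root_wordE Pi_based)[s [a [hs Pa ->]]].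
rewrite wprod_conj ?(simple_norm Pi_based) //; last exact: (word_unitPi Pi_based).
apply: weyl_wprod => //; apply/word_cat; split=> //; apply/word_cons; split=> //.
exact: word_rev.
Qed.

Lemma refl_root b : root b -> reflection B b b = - b.
Proof. by move=> rb; rewrite reflection_self // (root_norm Pi_based). Qed.

Lemma refl_rootK b : root b -> involutive (reflection B b).
Proof. by move=> rb; apply: reflectionK; apply: (root_norm Pi_based). Qed.

(** * Exchange and descents *)

(** The only positive root made negative by a simple reflection is its own. *)
Lemma simple_flip a b : Pi a -> root b -> pos b -> pos (- reflection B a b) -> b = a.
Proof.
move=> Pa rb pb; rewrite reflection1 ?(simple_norm Pi_based) // opprB.
set k := 2 * _ => hn.
have e : b + (k *: a - b) = k *: a by rewrite addrC subrK.
have k0 : 0 < k.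
  rewrite ltNge; apply/negP => k0.
  apply: (root_neq0 Pi_based rb).
  have h : pos (- (k *: a)).
    by rewrite -scaleNr; apply: coneZ; rewrite ?oppr_ge0 //; apply: cone_mem.
  apply: (pos_sum0 Pi_based pb (coneD hn h)).
  by rewrite addrA e subrr.
have kV : 0 <= k^-1 by rewrite invr_ge0 ltW.
have [|l l0 lE] := simple_extremal Pi_based Pa (coneZ kV pb) (coneZ kV hn).
  by rewrite -scalerDr e scalerA mulVf ?scale1r // gt_eqF.
apply: (simple_propor Pi_based (k := k * l) Pa).
- exact: (root_norm Pi_based).
- by rewrite mulr_ge0 // ltW.
- by rewrite -scalerA -lE scalerA mulfV ?scale1r // gt_eqF.
Qed.

(** Exchange condition *)
Lemma exchange s a : word Pi s -> Pi a -> pos (- wprod B s a) ->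
  exists s', [/\ word Pi s', (size s' < size s)%N &
                 wprod B s' = wprod B s \o reflection B a].
Proof.
move=> + Pa; elim: s => [_ h|c s IHs /word_cons[Pc hs] /= h].
  by case: (root_pos_neg Pi_based (simple_root Pi_based Pa) (cone_mem Pa) h).
have rsa := root_wprod Pi_based hs (simple_root Pi_based Pa).
have [p|/(IHs hs)[s' [hs' ss e]]] := root_sign Pi_based rsa; last first.
  by exists (c :: s'); split=> //; [apply/word_cons|rewrite /= e].
exists s; split=> //; apply/funext => v /=.
rewrite -(simple_flip Pc rsa p h) reflection_conj; last exact: (word_unitPi Pi_based).
by rewrite reflectionK ?(simple_norm Pi_based).
Qed.

Lemma descent_exists s : word Pi s -> wprod B s <> id ->
  exists2 a, Pi a & pos (- wprod B s a).
Proof.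
have [n sn] := ubnP (size s); elim: n => // n IHn in s sn *.
(* Either the last letter b is a descent, or the exchange condition shortens the
   word. *)
case/lastP: s sn => [|s b] //.
rewrite size_rcons ltnS -cats1 => sn /word_cat[hs hb].
have Pb : Pi b by apply: hb; rewrite inE.
have Eb : wprod B (s ++ [:: b]) = wprod B s \o reflection B b by rewrite wprod_cat.
rewrite Eb => ne.
have rb : root (wprod B s b) by apply: (root_wprod Pi_based hs); apply: simple_root.
have [p|/(exchange hs Pb)[s' [hs' ss e]]] := root_sign Pi_based rb.
  exists b => //=; rewrite reflection_self ?(simple_norm Pi_based) //.
  by rewrite wprodN opprK.
rewrite -e; rewrite -e in ne; apply: IHn => //; exact: leq_trans ss (ltnW sn).
Qed.

(** If all right descents of the elements of G lie in K and G is stable under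
    them, then G is contained in the standard parabolic subgroup of K. *)
Lemma descent_ind (G : set (V -> V)) K : G `<=` W -> K `<=` Pi ->
  (forall w a, G w -> Pi a -> pos (- w a) -> K a /\ G (w \o reflection B a)) ->
  G `<=` parabolic K.
Proof.
move=> GW KPi h w Gw; have /(weylE Pi_based)[s hs wE] := GW _ Gw.
have [n sn] := ubnP (size s); elim: n => // n IHn in w s Gw hs wE sn *.
have [->|ne] := pselect (w = id); first exact: group_id (parabolic_group KPi).
have [a Pa ha] : exists2 a, Pi a & pos (- w a).
  by rewrite wE; apply: descent_exists; rewrite -?wE.
have [Ka Gwa] := h w a Gw Pa ha.
have [s' [hs' ss e]] : exists s', [/\ word Pi s', (size s' < size s)%N &
    wprod B s' = wprod B s \o reflection B a] by apply: exchange; rewrite -?wE.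
have -> : w = (w \o reflection B a) \o reflection B a.
  by apply/funext => v /=; rewrite reflectionK ?(simple_norm Pi_based).
apply: (group_comp (parabolic_group KPi)); last exact: parabolic_mem.
apply: (IHn _ s') => //; first by rewrite e wE.
exact: leq_trans ss sn.
Qed.

(** The positive roots that w makes negative *)
Definition inversions w := [set b | [/\ root b, pos b & pos (- w b)]].

Lemma finite_inversions w : W w -> finite_set (inversions w).
Proof.
move=> /(weylE Pi_based)[s hs ->]; elim: s hs => [_|a s IHs /word_cons[Pa hs]].
  apply: (sub_finite_set (B := set0)) => // b [rb p n].
  exact: root_pos_neg Pi_based _ rb p n.
have s1 := word_unitPi Pi_based hs.
apply: (sub_finite_set (B := inversions (wprod B s) `|` [set wprod B (rev s) a])).
  move=> b [rb p /= n]; have rsb := root_wprod Pi_based hs rb.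
  have [q|q] := root_sign Pi_based rsb; last by left.
  by right => /=; rewrite -(simple_flip Pa rsb q n) wprod_revK.
by rewrite finite_setU; split; [apply: IHs|apply: finite_set1].
Qed.

Lemma inversions_inj w u : W w -> W u -> inversions w = inversions u -> w = u.
Proof.
move=> Ww Wu e; have [u' [Wu' u1 u2]] := weyl_inv Wu.
have Wx := weyl_comp Ww Wu'.
suff xid : w \o u' = id.
  by apply/funext => v; rewrite -[in LHS](u1 v) -[LHS]/((w \o u') (u v)) xid.
apply: contrapT => ne; have /(weylE Pi_based)[s hs xE] := Wx.
rewrite xE in ne; have [a Pa] := descent_exists hs ne; rewrite -xE /= => n.
have ra := simple_root Pi_based Pa; have rua := weyl_root Wu' ra.
have [p|p] := root_sign Pi_based rua.
  have : inversions w (u' a) by [].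
  rewrite e => -[_ _]; rewrite u2 => na.
  exact: (root_pos_neg Pi_based ra (cone_mem Pa) na).
have : inversions u (- u' a).
  split=> //; first exact: (opp_root Pi_based).
  by rewrite weylN // opprK u2; apply: cone_mem.
rewrite -e => -[_ _]; rewrite weylN // opprK.
by move/(root_pos_neg Pi_based (weyl_root Ww rua)); apply.
Qed.

(** * Stabilisers of reflection-linear functions *)

(** The stabiliser in W of a function on V *)
Definition stab (x : V -> R) : set (V -> V) := [set w | W w /\ x \o w = x].

Lemma stab_group x : is_group (stab x).
Proof.
split; first by split; first exact: (group_id weyl_is_group).
  move=> f g [Wf ef] [Wg eg]; split; first exact: weyl_comp.
  by rewrite compA ef.
move=> f [Wf ef]; have [f' [Wf' f1 f2]] := weyl_inv Wf; exists f'; split=> //.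
by split=> //; apply/funext => v /=; rewrite -{1}ef /= f2.
Qed.

Lemma rlinear_weyl w x : W w -> rlinear x -> rlinear (x \o w).
Proof. by move=> /(weylE Pi_based)[s hs ->]; apply: (rlinear_comp Pi_based). Qed.

Lemma rlinearN x b : rlinear x -> root b -> x (- b) = - x b.
Proof.
move=> [_ h] rb; rewrite -refl_root // h // (root_norm Pi_based rb); ring.
Qed.

(** The reflections fixing x are those in its zeros. *)
Lemma stab_refl x b : rlinear x -> root b -> x b = 0 <-> stab x (reflection B b).
Proof.
move=> [x0 xl] rb; split=> [xb|[_ e]].
  split; first exact: weyl_refl.
  apply/funext => v /=; have [rv|nv] := pselect (root v).
    by rewrite xl // xb mulr0 subr0.
  rewrite !x0 // => r; apply: nv; rewrite -[v](refl_rootK rb).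
  by apply: weyl_root => //; apply: weyl_refl.
have := congr1 (@^~ b) e; rewrite /= refl_root // rlinearN // => h.
by lra.
Qed.

Lemma dominant_pos x b : rlinear x -> (forall a, Pi a -> 0 <= x a) ->
  root b -> pos b -> 0 <= x b.
Proof.
move=> hx xd rb pb; have [n [c [a [h _ ->//]]]] := pos_root_comb Pi_based rb pb.
by apply: sumr_ge0 => i _; case: (h i) => c0 Pa; rewrite mulr_ge0 // xd.
Qed.

(** A dominant function has a standard parabolic stabiliser. *)
Lemma stab_dominant x K : rlinear x -> (forall a, Pi a -> 0 <= x a) ->
  (forall a, K a <-> Pi a /\ x a = 0) -> stab x = parabolic K.
Proof.
move=> hx xd KE; have KPi : K `<=` Pi by move=> a /KE[].
apply/seteqP; split.
  apply: descent_ind => //; first by move=> w [].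
  move=> w a [Ww xw] Pa n; have ra := simple_root Pi_based Pa.
  have xwa : x (w a) = x a by rewrite -[in RHS]xw.
  have xa : x a = 0.
    apply/le_anti; rewrite xd // andbT -xwa -oppr_ge0 -rlinearN //; last exact: weyl_root.
    apply: dominant_pos => //; apply: (opp_root Pi_based); exact: weyl_root.
  split; first exact/KE.
  apply: (group_comp (stab_group x)) => //.
  by apply/stab_refl.
apply: generated_sub; first exact: stab_group.
move=> _ [a /KE[Pa xa] <-]; apply/stab_refl => //; exact: simple_root.
Qed.

(** Standard parabolic subgroups are stabilisers. *)
Lemma parabolic_stab K : K `<=` Pi -> exists x,
  [/\ rlinear x, forall a, Pi a -> 0 <= x a, forall a, K a <-> Pi a /\ x a = 0 &
      stab x = parabolic K].
Proof.
move=> KPi.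
have [x hx xE] := rlinear_ext Pi_based (fun v => if `[< K v >] then 0 else 1 : R).
have xd a : Pi a -> 0 <= x a by move=> Pa; rewrite xE //; case: ifP.
have KE a : K a <-> Pi a /\ x a = 0.
  split=> [Ka|[Pa]]; first by split; [apply: KPi|rewrite xE; [rewrite asboolT|apply: KPi]].
  by rewrite xE //; case: asboolP => // _ /eqP; rewrite oner_eq0.
by exists x; split=> //; apply: stab_dominant.
Qed.

(** The positive roots of a standard parabolic subgroup are combinations of its
    simple roots. *)
Lemma parabolic_root_comb K b : K `<=` Pi -> root b -> pos b ->
  parabolic K (reflection B b) ->
  exists n (c : 'I_n -> R) (a : 'I_n -> V),
    [/\ forall i, [/\ 0 <= c i, Pi (a i) & c i != 0 -> K (a i)],
        b = \sum_i c i *: a i & forall x, rlinear x -> x b = \sum_i c i * x (a i)].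
Proof.
move=> KPi rb pb; have [z [hz zd KE <-]] := parabolic_stab KPi.
move=> /(stab_refl hz rb) zb.
have [n [c [a [h bE e]]]] := pos_root_comb Pi_based rb pb.
exists n, c, a; split=> // i; case: (h i) => c0 Pa; split=> // ci; apply/KE; split=> //.
move: zb; rewrite e // => /psumr_eq0P => /(_ _)/wrap[j _|/(_ i isT)/eqP].
  by case: (h j) => cj Paj; rewrite mulr_ge0 // zd.
by rewrite mulf_eq0 (negPf ci) /= => /eqP.
Qed.

Lemma parabolic_nonneg x K b : K `<=` Pi -> rlinear x -> (forall a, K a -> 0 <= x a) ->
  root b -> pos b -> parabolic K (reflection B b) -> 0 <= x b.
Proof.
move=> KPi hx xK rb pb hb; have [n [c [a [h _ ->//]]]] := parabolic_root_comb KPi rb pb hb.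
apply: sumr_ge0 => i _; have [c0 Pa Ka] := h i.
by have [->|/Ka/xK xa] := eqVneq (c i) 0; rewrite ?mul0r // mulr_ge0.
Qed.

Lemma refl_conj w w' b : W w -> cancel w' w ->
  w \o reflection B b \o w' = reflection B (w b).
Proof. by move=> Ww w2; apply/funext => v /=; rewrite weyl_reflection // w2. Qed.

(** A descent of an element of a standard parabolic subgroup is a simple root of
    that subgroup. *)
Lemma parabolic_descent K w a : K `<=` Pi -> parabolic K w -> Pi a -> pos (- w a) ->
  K a /\ parabolic K (reflection B (w a)).
Proof.
move=> KPi Kw Pa n; have Ww := parabolic_weyl KPi Kw.
have ra := simple_root Pi_based Pa; have rwa := weyl_root Ww ra.
have Ka : K a.
  have [z [hz zd KE zs]] := parabolic_stab KPi.
  apply/KE; split=> //; move: Kw; rewrite -zs => -[_ zw].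
  apply/le_anti; rewrite zd // andbT -[X in X a]zw /= -oppr_ge0 -rlinearN //.
  apply: dominant_pos => //; exact: (opp_root Pi_based).
split=> //; have [w' [Kw' w1 w2]] := group_inv (parabolic_group KPi) Kw.
rewrite -(refl_conj a Ww w2); have KG := parabolic_group KPi.
exact: (group_comp KG (group_comp KG Kw (parabolic_mem Ka))).
Qed.

(** * Functions that are negative on finitely many positive roots *)

(** The positive roots at which x is negative *)
Definition negatives x := [set b | [/\ root b, pos b & x b < 0]].

(** For reflection-linear functions, this is membership of the Tits cone
    ([almost_pos_dominate]). *)
Definition almost_pos x := finite_set (negatives x).

Lemma dominant_almost_pos x : rlinear x -> (forall a, Pi a -> 0 <= x a) -> almost_pos x.
Proof.
move=> hx xd; apply: (sub_finite_set (B := set0)) => // b [rb pb].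
by rewrite ltNge (dominant_pos hx xd rb pb).
Qed.

Lemma almost_pos_weyl w x : W w -> almost_pos x -> almost_pos (x \o w).
Proof.
move=> Ww hx; have [w' [Ww' w1 w2]] := weyl_inv Ww.
apply: (sub_finite_set (B := (w' @` negatives x) `|` inversions w)).
  move=> b [rb pb /= xb]; have rwb := weyl_root Ww rb.
  have [p|p] := root_sign Pi_based rwb; last by right.
  by left; exists (w b).
by rewrite finite_setU; split; [apply: finite_image|apply: finite_inversions].
Qed.

(** Such a function can be made non-negative on any set J of simple roots by an
    element of the standard parabolic subgroup of J. *)
Lemma almost_pos_dominate x J : J `<=` Pi -> rlinear x -> almost_pos x ->
  exists2 u, parabolic J u & forall a, J a -> 0 <= x (u a).
Proof.
move=> JPi hx /finite_seqP[l lE].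
have {lE} : forall b, root b -> pos b -> x b < 0 -> b \in l.
  move=> b rb pb xb; have : negatives x b by [].
  by rewrite lE.
have [n ln] := ubnP (size l); elim: n => // n IHn in x hx l ln *; move=> hl.
have [xJ|/existsNP[a /not_implyP[Ja /negP]]] := pselect (forall a, J a -> 0 <= x a).
  by exists id => //; apply: group_id (parabolic_group JPi).
rewrite -ltNge => xa; have Pa := JPi _ Ja; have ra := simple_root Pi_based Pa.
have al : a \in l by apply: hl => //; apply: cone_mem.
pose s := reflection B a.
have sK : involutive s by apply: refl_rootK.
have [|||u Ju hu] := IHn (x \o s) _ [seq s b | b <- rem a l].
- by apply: rlinear_weyl => //; apply: weyl_simple.
- by rewrite size_map size_rem //; case: (l) al ln.
- move=> b rb pb /= xb.
  have rsb : root (s b) by apply: weyl_root => //; apply: weyl_simple.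
  have [p|p] := root_sign Pi_based rsb; last first.
    move: xb; rewrite (simple_flip Pa rb pb p) /s refl_root // rlinearN //.
    by rewrite oppr_lt0 ltNge ltW.
  rewrite -[b]sK map_f //; apply: rem_mem; last exact: hl.
  apply/eqP => sba; apply: (root_pos_neg Pi_based rb pb).
  by rewrite -[b]sK sba /s refl_root // opprK; apply: cone_mem.
exists (s \o u) => //.
by apply: (group_comp (parabolic_group JPi)) => //; apply: parabolic_mem.
Qed.

Lemma stab_conj w x : W w -> stab x = conjugate w (stab (x \o w)).
Proof.
move=> Ww; have [w' [Ww' w1 w2]] := weyl_inv Ww.
apply/seteqP; split=> h.
  move=> [Wh hx]; apply/(conjugateP _ _ w1 w2); split.
    by apply: weyl_comp => //; apply: weyl_comp.
  by apply/funext => v /=; rewrite w2 -[in RHS]hx.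
move=> /(conjugateP _ _ w1 w2)[Wh hx].
have hE : h = w \o (w' \o h \o w) \o w' by apply/funext => v /=; rewrite !w2.
split; first by rewrite hE; exact: (weyl_comp (weyl_comp Ww Wh) Ww').
apply/funext => v; have := congr1 (@^~ (w' v)) hx.
by rewrite /= !w2.
Qed.

Lemma stab_parabolic x : rlinear x -> almost_pos x -> is_parabolic B Pi (stab x).
Proof.
move=> hx ax; have [w Ww wd] := almost_pos_dominate (@subset_refl _ Pi) hx ax.
exists w, [set a | Pi a /\ x (w a) = 0]; split=> //; first by move=> a [].
rewrite (stab_conj x Ww); congr conjugate.
by apply: stab_dominant => //; apply: rlinear_weyl.
Qed.

(** Every parabolic subgroup is the stabiliser of such a function. *)
Lemma parabolic_is_stab U : is_parabolic B Pi U ->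
  exists x, [/\ rlinear x, almost_pos x & stab x = U].
Proof.
move=> [w [K [Ww KPi ->]]]; have [w' [Ww' w1 w2]] := weyl_inv Ww.
have [z [hz zd KE zs]] := parabolic_stab KPi.
exists (z \o w'); split.
- exact: rlinear_weyl.
- by apply: almost_pos_weyl => //; apply: dominant_almost_pos.
- rewrite (stab_conj _ Ww) -zs; congr (conjugate _ (stab _)).
  by apply/funext => v /=; rewrite w1.
Qed.

Lemma parabolic_conjugate w U : W w -> is_parabolic B Pi U ->
  is_parabolic B Pi (conjugate w U).
Proof.
move=> Ww [u [K [Wu KPi ->]]]; exists (w \o u), K; split=> //; first exact: weyl_comp.
have [w' [_ w1 w2]] := weyl_inv Ww; have [u' [_ u1 u2]] := weyl_inv Wu.
exact: conjugate_comp w1 w2 u1 u2.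
Qed.

(** The intersection of two parabolic subgroups is parabolic. *)
Lemma parabolic_inter U1 U2 : is_parabolic B Pi U1 -> is_parabolic B Pi U2 ->
  is_parabolic B Pi (U1 `&` U2).
Proof.
move=> [w [J [Ww JPi ->]]] /parabolic_is_stab[y [hy ay <-]].
have [w' [Ww' w1 w2]] := weyl_inv Ww.
rewrite (stab_conj y Ww) -(conjugateI _ _ w1 w2).
apply: (parabolic_conjugate Ww).
have {y hy ay} [y [hy ay ->]] : exists y', [/\ rlinear y', almost_pos y' & stab (y \o w) = stab y'].
  by exists (y \o w); split=> //; [apply: rlinear_weyl|apply: almost_pos_weyl].
have [u Ju yu] := almost_pos_dominate JPi hy ay.
have Wu := parabolic_weyl JPi Ju.
have [u' [Ju' u1 u2]] := group_inv (parabolic_group JPi) Ju.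
have JE := conjugate_self (parabolic_group JPi) Ju.
rewrite -{1}JE (stab_conj y Wu) -(conjugateI _ _ u1 u2).
apply: (parabolic_conjugate Wu); have {}hy := rlinear_weyl Wu hy.
have {yu} yJ : forall a, J a -> 0 <= (y \o u) a := yu.
move: (y \o u) hy yJ {ay} => {}y hy yJ.
exists id, [set a | J a /\ y a = 0]; split; first exact: (group_id weyl_is_group).
  by move=> a [/JPi].
have -> : conjugate id (parabolic [set a | J a /\ y a = 0]) =
          parabolic [set a | J a /\ y a = 0].
  apply/seteqP; split=> h; first by move=> [g ? e]; rewrite -[h]/(h \o id) e.
  by exists h.
apply/seteqP; split; last first.
  apply: generated_sub.
    by apply: group_inter; [apply: parabolic_group|apply: stab_group].
  move=> _ [a [Ja ya] <-]; split; first exact: parabolic_mem.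
  by apply/stab_refl => //; apply: (simple_root Pi_based); apply: JPi.
apply: descent_ind => [h [_ []]//|a [/JPi]//|h a [Jh [Wh yh]] Pa n].
have [Ja Jha] := parabolic_descent JPi Jh Pa n.
have ra := simple_root Pi_based Pa; have rha := weyl_root Wh ra.
have yha : y (h a) = y a by rewrite -[in RHS]yh.
have ya : y a = 0.
  apply/le_anti; rewrite yJ // andbT -yha -oppr_ge0 -rlinearN //.
  apply: (parabolic_nonneg JPi) => //; first exact: (opp_root Pi_based).
  by rewrite reflectionN.
split=> //; split.
  by apply: (group_comp (parabolic_group JPi)) => //; apply: parabolic_mem.
by apply: (group_comp (stab_group y)) => //; apply/stab_refl.
Qed.

(** * Double cosets *)

(** A double coset of two standard parabolic subgroups contains an element with
    no left descent in K and no right descent in J. *)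
Lemma min_double_coset w J K : W w -> J `<=` Pi -> K `<=` Pi ->
  exists v u g g', [/\ parabolic K v, parabolic J u, g = v \o w \o u, W g' &
    [/\ cancel g g', cancel g' g, forall a, J a -> pos (g a) & forall k, K k -> pos (g' k)]].
Proof.
move=> Ww JPi KPi.
pose inD g := exists v u, [/\ parabolic K v, parabolic J u & g = v \o w \o u].
have exP : exists k, `[< exists s, [/\ word Pi s, size s = k & inD (wprod B s)] >].
  have /(weylE Pi_based)[s hs wE] := Ww; exists (size s); apply/asboolP; exists s; split=> //.
  exists id, id; split; rewrite ?wE //; exact: group_id (parabolic_group _).
case: (ex_minnP exP) => k /asboolP[s [hs <- [v [u [Kv Ju e]]]]] kmin.
have s1 := word_unitPi Pi_based hs.
have minD t : word Pi t -> inD (wprod B t) -> (size s <= size t)%N.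
  by move=> ht Dt; apply: kmin; apply/asboolP; exists t.
exists v, u, (wprod B s), (wprod B (rev s)); split=> //.
  by apply: (weyl_wprod Pi_based); apply: word_rev.
split; [exact: wprod_revK|exact: wprodK| |].
- move=> a Ja; have Pa := JPi _ Ja.
  have rsa := root_wprod Pi_based hs (simple_root Pi_based Pa).
  have [//|/(exchange hs Pa)[t [ht st et]]] := root_sign Pi_based rsa.
  suff : (size s <= size t)%N by rewrite leqNgt st.
  apply: minD => //; exists v, (u \o reflection B a); split=> //.
    by apply: (group_comp (parabolic_group JPi)) => //; apply: parabolic_mem.
  by rewrite et e.
- move=> a Ka; have Pa := KPi _ Ka; have hs' := word_rev hs.
  have rsa := root_wprod Pi_based hs' (simple_root Pi_based Pa).
  have [//|/(exchange hs' Pa)[t [ht st et]]] := root_sign Pi_based rsa.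
  suff : (size s <= size (rev t))%N by rewrite size_rev leqNgt -[size s]size_rev st.
  apply: minD; first exact: word_rev.
  exists (reflection B a \o v), u; split=> //.
    by apply: (group_comp (parabolic_group KPi)) => //; apply: parabolic_mem.
  have t1 := word_unitPi Pi_based ht.
  have a1 := simple_norm Pi_based Pa.
  transitivity (reflection B a \o wprod B s); last by rewrite e.
  apply: (cancel_uniq (g := wprod B t)); first exact: wprodK.
  by rewrite et => x /=; rewrite wprodK ?reflectionK.
Qed.

(** If g makes no simple root of J negative, its inverse makes no simple root of
    K negative, and g conjugates the reflections of J into the subgroup of K,
    then g maps J into K. *)
Lemma min_double_coset_simple g g' J K : W g -> W g' -> cancel g g' -> cancel g' g ->
  J `<=` Pi -> K `<=` Pi ->
  (forall a, J a -> pos (g a)) -> (forall k, K k -> pos (g' k)) ->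
  (forall a, J a -> parabolic K (reflection B (g a))) -> g @` J `<=` K.
Proof.
move=> Wg Wg' g1 g2 JPi KPi gJ gK h _ [a Ja <-].
have Pa := JPi _ Ja; have rga := weyl_root Wg (simple_root Pi_based Pa).
have [n [c [k [hk gaE _]]]] := parabolic_root_comb KPi rga (gJ _ Ja) (h _ Ja).
have aE : \sum_i c i *: (if c i == 0 then a else g' (k i)) = a.
  rewrite -[RHS]g1 gaE weyl_sum //; apply: eq_bigr => i _.
  by case: eqP => // ->; rewrite !scale0r.
have ka i : c i != 0 -> k i = g a.
  move=> ci; have /= := simple_comb Pi_based Pa _ aE ci.
  rewrite (negPf ci) => <-; first by rewrite g2.
  move=> j; have [cj Pk Kk] := hk j; split=> //; case: eqVneq => [_|/Kk{}Kk].
    by split; [apply: cone_mem|apply: (simple_norm Pi_based)].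
  by split; [apply: gK|rewrite weyl_isom // (simple_norm Pi_based)].
have [[i ci]|/forallNP c0] := pselect (exists i, c i != 0).
  by rewrite -(ka i ci); case: (hk i) => _ _; apply.
case: (root_neq0 Pi_based rga); rewrite gaE big1 // => i _.
by have /negP/negbNE/eqP -> := c0 i; rewrite scale0r.
Qed.

End Weyl.

(** * Finite index *)

Section FiniteIndex.
Variable V : choiceType.
Implicit Types (G H : set (V -> V)) (w g h : V -> V).

Lemma coset_eq H (f h : V -> V) : is_group H -> H h ->
  [set (f \o h) \o k | k in H] = [set f \o k | k in H].
Proof.
move=> hH Hh; have [h' [Hh' h1 h2]] := group_inv hH Hh.
apply/seteqP; split=> [_ [k Hk <-]|_ [k Hk <-]].
  by exists (h \o k) => //; apply: group_comp.
exists (h' \o k); first exact: group_comp.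
by apply/funext => v /=; rewrite h2.
Qed.

Lemma finite_index_cover G H (F : set (V -> V)) : is_group H -> finite_set F ->
  (forall g, G g -> exists f h, [/\ F f, H h & g = f \o h]) -> finite_index G H.
Proof.
move=> hH fF hF; apply: (sub_finite_set (B := (fun f => [set f \o k | k in H]) @` F)).
  by move=> _ [g /hF[f [h [Ff Hh ->]]] <-]; exists f => //; rewrite coset_eq.
exact: finite_image.
Qed.

Lemma finite_index_sub G G' H : G `<=` G' -> finite_index G' H -> finite_index G H.
Proof. by move=> GG'; apply: sub_finite_set; apply: image_subset. Qed.

(** A set of representatives, listed without repetition, of the right cosets of
    H in G. *)
Definition right_transversal G H (rs : seq (V -> V)) :=
  [/\ uniq rs, forall r, r \in rs -> G r,
      forall g, G g -> exists r h, [/\ r \in rs, H h & g = h \o r] &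
      forall r1 r2 h, r1 \in rs -> r2 \in rs -> H h -> r1 = h \o r2 -> r1 = r2].

Lemma right_transversal_exists G H : is_group G -> is_group H -> H `<=` G ->
  finite_index G H -> exists rs, right_transversal G H rs.
Proof.
move=> hG hH HG fin.
pose cov (rs : seq (V -> V)) := (forall r, r \in rs -> G r) /\
  forall g, G g -> exists r h, [/\ r \in rs, H h & g = h \o r].
have exc : exists rs, cov rs.
  have /finite_seqP[cs csE] := fin.
  have repP (C : set (V -> V)) : exists r, left_cosets G H C -> G r /\
      exists w, [/\ cancel w r, cancel r w & C = [set w \o h | h in H]].
    have [[w Gw <-]|nC] := pselect (left_cosets G H C); last by exists id.
    have [r [Gr r1 r2]] := group_inv hG Gw.
    by exists r => _; split=> //; exists w.
  have [rep hrep] := choice repP.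
  have csP C : C \in cs -> left_cosets G H C by move=> Ccs; rewrite csE.
  exists (map rep cs); split=> [_ /mapP[C /csP/hrep[? _] ->]//|g Gg].
  have [g' [Gg' g1 g2]] := group_inv hG Gg.
  pose C := [set g' \o h | h in H].
  have hC : left_cosets G H C by exists g'.
  have Ccs : C \in cs by move: hC; rewrite csE.
  have [Gr [w [r1 r2 CE]]] := hrep _ hC.
  have : C g' by exists id => //; apply: group_id.
  rewrite CE => -[h Hh g'E]; have [h' [Hh' h1 h2]] := group_inv hH Hh.
  exists (rep C), h'; split=> //; first exact: map_f.
  apply: (cancel_uniq (g := g')) => // v /=.
  by rewrite -g'E /= r1 h1.
have exn : exists n, `[< exists2 rs, cov rs & size rs = n >].
  by have [rs hrs] := exc; exists (size rs); apply/asboolP; exists rs.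
(* A covering list of minimal length has no two members in the same coset. *)
case: (ex_minnP exn) => _ /asboolP[rs [rsG rsc] <-] smin.
have shorter r : r \in rs -> ~ cov (rem r rs).
  move=> rrs hc; have : (size rs <= size (rem r rs))%N.
    by apply: smin; apply/asboolP; exists (rem r rs).
  by rewrite size_rem //; case: (rs) rrs => //= ? ? _; rewrite ltnn.
have rem_cov r r' h : r \in rs -> r' \in rem r rs -> H h -> r = h \o r' -> False.
  move=> rrs r'rs Hh rE; apply: (shorter _ rrs); split=> [q /mem_rem/rsG//|g Gg].
  have [q [k [qrs Hk gE]]] := rsc _ Gg; have [qr|qr] := eqVneq q r.
    exists r', (k \o h); split=> //; first exact: group_comp.
    by rewrite gE qr rE.
  by exists q, k; split=> //; apply: rem_mem.
exists rs; split=> //.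
  rewrite -[uniq rs]negbK -ltn_size_undup -leqNgt; apply: smin; apply/asboolP.
  exists (undup rs) => //; split=> [r|g /rsc[r [h [rrs Hh gE]]]].
    by rewrite mem_undup; apply: rsG.
  by exists r, h; rewrite mem_undup.
move=> r1 r2 h h1 h2 Hh e; apply: contrapT => /eqP ne.
by apply: (rem_cov r1 r2 h) => //; apply: rem_mem => //; rewrite eq_sym.
Qed.

End FiniteIndex.

(** * Sums over orbits *)

Section Averaging.
Variables (R : realType) (V : lmodType R) (B : {symmetric V}) (Pi : set V).
Hypothesis Pi_based : is_based_root_system B Pi.

Local Notation W := (weyl_group B Pi).
Local Notation root := (root_system B Pi).
Local Notation pos := (cone Pi).
Local Notation rlinear := (rlinear B Pi).
Local Notation stab := (stab B Pi).
Local Notation almost_pos := (almost_pos B Pi).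
Local Notation parabolic K := (standard_parabolic B K).
Implicit Types (J K : set V) (w u g : V -> V) (x y p : V -> R).

(** For rs a transversal of the stabiliser of p, the sum of the orbit of p *)
Definition orbit_sum p (rs : seq (V -> V)) : V -> R := fun v => \sum_(r <- rs) p (r v).

Lemma rlinear_lin (k : R) x y : rlinear x -> rlinear y -> rlinear (fun v => k * x v + y v).
Proof.
move=> [x0 xl] [y0 yl]; split=> [b nb|b g rb rg]; first by rewrite x0 // y0 // mulr0 addr0.
by rewrite xl // yl //; ring.
Qed.

Lemma rlinear0 : rlinear (fun=> 0).
Proof. by split=> [//|b g _ _]; rewrite mulr0 subr0. Qed.

Lemma rlinear_sum (I : eqType) (s : seq I) (k : I -> R) (f : I -> V -> R) :
  (forall i, i \in s -> rlinear (f i)) -> rlinear (fun v => \sum_(i <- s) k i * f i v).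
Proof.
elim: s => [_|i s IHs h].
  rewrite (_ : (fun _ => _) = fun=> 0); first exact: rlinear0.
  by apply/funext => v; rewrite big_nil.
rewrite (_ : (fun _ => _) = fun v => k i * f i v + \sum_(j <- s) k j * f j v).
  apply: rlinear_lin; first by apply: h; rewrite mem_head.
  by apply: IHs => j js; apply: h; rewrite inE js orbT.
by apply/funext => v; rewrite big_cons.
Qed.

Lemma rlinear_orbit_sum p rs : rlinear p -> (forall r, r \in rs -> W r) ->
  rlinear (orbit_sum p rs).
Proof.
move=> hp h.
rewrite (_ : orbit_sum p rs = fun v => \sum_(r <- rs) 1 * (p \o r) v).
  by apply: rlinear_sum => r /h Wr; apply: (rlinear_weyl Pi_based).
by apply/funext => v; apply: eq_bigr => r _; rewrite mul1r.
Qed.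

(** Right multiplication by g in G permutes the right cosets of H. *)
Lemma transversal_perm G H rs g (T : Type) (idx : T) (op : Monoid.com_law idx)
    (F : (V -> V) -> T) :
  is_group G -> is_group H -> right_transversal G H rs -> G g ->
  (forall h u, H h -> F (h \o u) = F u) ->
  \big[op/idx]_(r <- rs) F (r \o g) = \big[op/idx]_(r <- rs) F r.
Proof.
move=> hG hH [urs rsG rsc rsi] Gg FH.
have sP r : exists t, r \in rs -> t \in rs /\ exists2 h, H h & r \o g = h \o t.
  have [rrs|_] := boolP (r \in rs); last by exists id.
  have [t [h [trs Hh e]]] := rsc _ (group_comp hG (rsG _ rrs) Gg).
  by exists t => _; split=> //; exists h.
have [s sE] := choice sP.
have [g' [Gg' g1 g2]] := group_inv hG Gg.
have us : uniq (map s rs).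
  rewrite map_inj_in_uniq // => r1 r2 r1s r2s e.
  have [ts [h1 Hh1 e1]] := sE _ r1s; have [_ [h2 Hh2 e2]] := sE _ r2s.
  have [h2' [Hh2' k1 k2]] := group_inv hH Hh2.
  apply: (rsi r1 r2 (h1 \o h2')) => //; first exact: group_comp.
  apply/funext => v; rewrite -[v]g2 -[LHS]/((r1 \o g) (g' v)) e1 /= e.
  by rewrite -[s r2 _]k1 -[h2 _]/((h2 \o s r2) (g' v)) -e2.
have ss : {subset map s rs <= rs} by move=> _ /mapP[r /sE[? _] ->].
have [_ ms] := uniq_min_size us ss (eq_leq (esym (size_map s rs))).
rewrite -[RHS](perm_big _ (uniq_perm us urs ms)) big_map.
by apply: eq_big_seq => r /sE[_ [h Hh ->]]; apply: FH.
Qed.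

Lemma orbit_sum_inv G H p rs g : is_group G -> is_group H ->
  right_transversal G H rs -> (forall h, H h -> p \o h = p) -> G g ->
  orbit_sum p rs \o g = orbit_sum p rs.
Proof.
move=> hG hH hrs pH Gg; apply/funext => v /=.
rewrite /orbit_sum; apply: (transversal_perm (F := fun r => p (r v)) _ hG hH hrs Gg).
by move=> h u /pH e; rewrite -[in RHS]e.
Qed.

Lemma almost_pos_sum (s : seq (V -> R)) : (forall f, f \in s -> almost_pos f) ->
  almost_pos (fun v => \sum_(f <- s) f v).
Proof.
move=> h; apply: (sub_finite_set (B := \bigcup_(f in [set` s]) negatives B Pi f)).
  move=> b [rb pb]; rewrite ltNge => /negP nb; apply: contrapT => nf; apply: nb.
  rewrite big_seq; apply: sumr_ge0 => f fs; rewrite leNgt; apply/negP => fb.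
  by apply: nf; exists f.
by apply: bigcup_finite; [apply: finite_seq|move=> f /h].
Qed.

Lemma almost_pos_orbit_sum p rs : almost_pos p -> (forall r, r \in rs -> W r) ->
  almost_pos (orbit_sum p rs).
Proof.
move=> hp h; rewrite (_ : orbit_sum p rs = fun v => \sum_(f <- [seq p \o r | r <- rs]) f v).
  by apply: almost_pos_sum => _ /mapP[r /h Wr ->]; apply: (almost_pos_weyl Pi_based).
by apply/funext => v; rewrite big_map.
Qed.

(** * The stabiliser of the sum over an orbit *)

(** At all but finitely many of the roots where the orbit sum vanishes, p vanishes
    too, because a vanishing sum with a non-zero term has a negative term. *)
Lemma finite_moved_roots G H p rs : right_transversal G H rs -> G `<=` W -> G id ->
  rlinear p -> almost_pos p -> (forall h, H h -> p \o h = p) ->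
  finite_set [set b | [/\ root b, orbit_sum p rs b = 0 & p b <> 0]].
Proof.
move=> [_ rsG rsc _] GW Gid hp ap pH.
pose N := \bigcup_(r in [set` rs]) negatives B Pi (p \o r).
have fN : finite_set N.
  apply: bigcup_finite; first exact: finite_seq.
  by move=> r /rsG/GW Wr; apply: (almost_pos_weyl Pi_based).
have hx : rlinear (orbit_sum p rs) by apply: rlinear_orbit_sum => // r /rsG/GW.
have key b : root b -> pos b -> orbit_sum p rs b = 0 -> p b <> 0 -> N b.
  move=> rb pb xb; apply: contra_notP => nN.
  have [r [h [rrs Hh e]]] := rsc _ Gid.
  have ge0 q : q \in rs -> 0 <= p (q b).
    move=> qrs; rewrite leNgt; apply/negP => qb; apply: nN.
    by exists q.
  have -> : p b = p (r b) by rewrite -[b in LHS]/(id b) e -[p in RHS](pH h Hh).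
  move: xb; rewrite /orbit_sum (big_rem r) //= => /eqP.
  rewrite paddr_eq0 ?ge0 //; first by case/andP => /eqP.
  by rewrite big_seq; apply: sumr_ge0 => q /mem_rem; apply: ge0.
apply: (sub_finite_set (B := N `|` (fun v => - v) @` N)); last first.
  by rewrite finite_setU; split=> //; apply: finite_image.
move=> b [rb xb pb]; have [p0|p0] := root_sign Pi_based rb; first by left; apply: key.
right; exists (- b); rewrite ?opprK //; apply: key => //; first exact: opp_root.
  by rewrite (rlinearN Pi_based) // xb oppr0.
by rewrite (rlinearN Pi_based) // => /eqP; rewrite oppr_eq0 => /eqP.
Qed.

(** The inversions of an element of a standard parabolic subgroup are roots of
    that subgroup. *)
Lemma inversion_reflection K w b : K `<=` Pi -> parabolic K w ->
  inversions B Pi w b -> parabolic K (reflection B b).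
Proof.
move=> KPi Kw [rb pb n]; have [z [hz zd KE zs]] := parabolic_stab Pi_based KPi.
rewrite -zs; apply/(stab_refl Pi_based) => //.
move: (Kw); rewrite -zs => -[Ww zw].
apply/le_anti; rewrite (dominant_pos Pi_based) // andbT -[X in X b]zw /= -oppr_ge0.
rewrite -(rlinearN Pi_based) //; last exact: weyl_root.
by apply: (dominant_pos Pi_based) => //; apply: (opp_root Pi_based); apply: weyl_root.
Qed.

Lemma finite_inversions_in (A : set V) : finite_set A ->
  finite_set [set w | W w /\ inversions B Pi w `<=` A].
Proof.
move=> /finite_seqP[l lE]; set F := [set w | _].
pose code w := [ffun i : 'I_(size l) => `[< inversions B Pi w (nth 0 l i) >]].
pose dec c : V -> V := xget (id : V -> V) [set w : V -> V | F w /\ code w = c].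
apply: (sub_finite_set (B := dec @` setT)); last first.
  by apply: finite_image; apply: finite_finset.
move=> w Fw; exists (code w) => //.
have [Fd cd] : F (dec (code w)) /\ code (dec (code w)) = code w.
  by rewrite /dec; case: xgetP => [u -> //|/(_ w)]; case; split.
case: (Fw) (Fd) => Ww wA [Wd dA]; apply: (inversions_inj Pi_based) => //.
have aux b : A b -> inversions B Pi (dec (code w)) b = inversions B Pi w b.
  rewrite lE /= => bl; have i : (index b l < size l)%N by rewrite index_mem.
  have := congr1 (fun f : {ffun _} => f (Ordinal i)) cd.
  rewrite !ffunE /= nth_index // => e.
  by apply/propext; split=> /asboolP; rewrite (e, esym e) => /asboolP.
by apply/seteqP; split=> b hb; [rewrite -aux //; apply: dA|rewrite aux //; apply: wA].
Qed.

Lemma parabolic0 : parabolic set0 = [set id].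
Proof.
apply/seteqP; split=> [|_ ->]; last by move=> G [[]].
apply: generated_sub => [|_ [a []]//].
split=> [//|_ _ -> ->//|_ ->]; by exists id.
Qed.

Lemma parabolic_image_sub J g g' : W g -> cancel g g' -> cancel g' g ->
  J `<=` Pi -> parabolic (g @` J) `<=` conjugate g (parabolic J).
Proof.
move=> Wg g1 g2 JPi; apply: generated_sub.
  by apply: (conjugate_group g1 g2); apply: (parabolic_group Pi_based).
move=> _ [_ [a Ja <-] <-]; apply/(conjugateP _ _ g1 g2).
rewrite (_ : _ \o g = reflection B a); first exact: parabolic_mem.
by apply/funext => v /=; rewrite -(weyl_reflection Pi_based) // g1.
Qed.

Lemma parabolic_image J g : W g -> J `<=` Pi -> g @` J `<=` Pi ->
  parabolic (g @` J) = conjugate g (parabolic J).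
Proof.
move=> Wg JPi gJPi; have [g' [Wg' g1 g2]] := weyl_inv Pi_based Wg.
apply/seteqP; split; first exact: parabolic_image_sub g1 g2 JPi.
move=> h /(conjugateP _ _ g1 g2) hh.
have := @parabolic_image_sub (g @` J) g' g Wg' g2 g1 gJPi.
rewrite image_comp (_ : g' \o g = id); last exact/funext.
rewrite image_id => /(_ _ hh)/(conjugateP _ _ g2 g1).
by rewrite (_ : _ \o g' = h) //; apply/funext => v /=; rewrite !g2.
Qed.

(** A parabolic subgroup containing the standard one of J can be conjugated to a
    standard one, in such a way that J is mapped to simple roots. *)
Lemma parabolic_overgroup U J : J `<=` Pi -> is_parabolic B Pi U -> parabolic J `<=` U ->
  exists g g' K, [/\ W g, W g', cancel g g', cancel g' g &
    [/\ K `<=` Pi, g @` J `<=` K & U = conjugate g' (parabolic K)]].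
Proof.
move=> JPi [w [K [Ww KPi UE]]] JU; have [w' [Ww' w1 w2]] := weyl_inv Pi_based Ww.
have [v [u [g [g' [Kv Ju gE Wg' [g1 g2 gJ gK]]]]]] := min_double_coset Pi_based Ww' JPi KPi.
have Wg : W g.
  rewrite gE; apply: (weyl_comp Pi_based).
    by apply: (weyl_comp Pi_based) => //; exact: (parabolic_weyl Pi_based KPi).
  exact: (parabolic_weyl Pi_based JPi).
have hU : is_group U.
  by rewrite UE; apply: (conjugate_group w1 w2); apply: (parabolic_group Pi_based).
have Uu := JU _ Ju; have KG := parabolic_group Pi_based KPi.
have [u' [Uu' u1 u2]] := group_inv hU Uu; have [v' [Kv' v1 v2]] := group_inv KG Kv.
have g'E : g' = u' \o (w \o v').
  apply: (cancel_uniq (g := g)) => // t /=.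
  by rewrite gE /= v1 w2 u1.
have UE' : U = conjugate g' (parabolic K).
  have e1 : cancel (w \o v') (v \o w') by exact: can_comp.
  have e2 : cancel (v \o w') (w \o v') by exact: can_comp.
  rewrite g'E -(conjugate_comp _ u2 u1 e1 e2) -(conjugate_comp _ w1 w2 v2 v1).
  by rewrite (conjugate_self KG Kv') -UE (conjugate_self hU Uu').
exists g, g', K; split=> //; split=> //.
apply: (min_double_coset_simple Pi_based Wg Wg') => // a Ja.
have := JU _ (parabolic_mem Ja : parabolic J (reflection B a)).
rewrite UE' => /(conjugateP _ _ g2 g1).
by rewrite (refl_conj Pi_based).
Qed.

(** If p is negative on finitely many positive roots and its stabiliser is the
    standard parabolic subgroup of J, then the stabiliser of its W'-orbit sum is
    a parabolic subgroup in which the latter has finite index: p vanishes at all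
    but finitely many of its roots. *)
Lemma stab_orbit_sum p J W' rs : J `<=` Pi -> is_subgroup_of_W B Pi W' ->
  parabolic J `<=` W' -> rlinear p -> almost_pos p -> stab p = parabolic J ->
  right_transversal W' (parabolic J) rs ->
  finite_parabolic_overgroup B Pi J W' (stab (orbit_sum p rs)).
Proof.
move=> JPi [gW' W'W] JW' hp ap sp hrs; have JG := parabolic_group Pi_based JPi.
have [_ rsW' _ _] := hrs.
have pJ h : parabolic J h -> p \o h = p by rewrite -sp => -[].
have rsW r : r \in rs -> W r by move=> /rsW'/W'W.
have hx := rlinear_orbit_sum hp rsW.
set U := stab (orbit_sum p rs).
have W'U : W' `<=` U.
  by move=> w W'w; split; [apply: W'W|apply: orbit_sum_inv hrs pJ W'w].
have hU : is_parabolic B Pi U.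
  by apply: (stab_parabolic Pi_based) => //; apply: almost_pos_orbit_sum.
split=> //.
have JU : parabolic J `<=` U by move=> h /JW'/W'U.
have fA := finite_moved_roots hrs W'W (group_id gW') hp ap pJ.
set A := [set b | _] in fA.
have [g [g' [K [Wg Wg' g1 g2 [KPi gJK UE]]]]] := parabolic_overgroup JPi hU JU.
have gJPi : g @` J `<=` Pi by move=> b /gJK/KPi.
have JE := parabolic_image Wg JPi gJPi.
pose F := [set k | W k /\ inversions B Pi k `<=` g @` A].
apply: (finite_index_cover (F := (fun f => g' \o f \o g) @` F)) => //.
  by apply: finite_image; apply: finite_inversions_in; apply: finite_image.
move=> u; rewrite {1}UE => /(conjugateP _ _ g2 g1) Kk; set k := g \o u \o g' in Kk.
have KG := parabolic_group Pi_based KPi.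
have Wk := parabolic_weyl Pi_based KPi Kk.
have [v [i [k0 [k0' [+ Ii k0E Wk0' [_ _ kI _]]]]]] :=
  min_double_coset Pi_based Wk gJPi (@sub0set _ Pi).
rewrite parabolic0 => vE; rewrite vE in k0E.
have IK : parabolic (g @` J) `<=` parabolic K.
  apply: generated_sub => // _ [a /gJK Ka <-]; exact: parabolic_mem.
have Kk0 : parabolic K k0 by rewrite k0E; apply: (group_comp KG) => //; apply: IK.
have Wk0 := parabolic_weyl Pi_based KPi Kk0.
have [i' [Ii' i1 i2]] := group_inv (parabolic_group Pi_based gJPi) Ii.
(* The element k0 has no descent in g J, so its inversions are conjugate to roots
   at which p does not vanish. *)
exists (g' \o k0 \o g), (g' \o i' \o g); split; last first.
- by apply/funext => t /=; rewrite g2 k0E /= i2 /k /= !g1.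
- by move: Ii'; rewrite JE => /(conjugateP _ _ g1 g2).
exists k0 => //; split=> //.
move=> b bk0; have [rb pb nb] := bk0; have Kb := inversion_reflection KPi Kk0 bk0.
have rgb := weyl_root Pi_based Wg' rb.
exists (g' b); last by rewrite g2.
split=> //.
  apply/(stab_refl Pi_based hx rgb); rewrite -/U UE.
  apply/(conjugateP _ _ g2 g1); rewrite (refl_conj Pi_based) // g2.
  exact: Kb.
move=> /(stab_refl Pi_based hp rgb); rewrite sp => Jb.
have Ib : parabolic (g @` J) (reflection B b).
  rewrite JE; apply/(conjugateP _ _ g1 g2); move: Jb.
  by rewrite -(refl_conj Pi_based b Wg' g1).
have [n [c [a [h bE _]]]] := parabolic_root_comb Pi_based gJPi rb pb Ib.
apply: (root_pos_neg Pi_based (weyl_root Pi_based Wk0 rb) _ nb).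
rewrite bE (weyl_sum Pi_based) //.
apply: cone_sum => j _; have [c0 Pa Ja] := h j.
have [->|/Ja/kI] := eqVneq (c j) 0; first by rewrite scale0r; apply: cone0.
exact: coneZ.
Qed.

Lemma finite_overgroup J W' : J `<=` Pi -> is_subgroup_of_W B Pi W' ->
  parabolic J `<=` W' -> finite_index W' (parabolic J) ->
  exists U, finite_parabolic_overgroup B Pi J W' U.
Proof.
move=> JPi hW' JW' fin; have [z [hz zd _ zs]] := parabolic_stab Pi_based JPi.
have [rs hrs] := right_transversal_exists (proj1 hW') (parabolic_group Pi_based JPi) JW' fin.
exists (stab (orbit_sum z rs)); apply: stab_orbit_sum => //.
exact: (dominant_almost_pos Pi_based).
Qed.

(** * The least overgroup *)

(** An overgroup of least index is the least one, since overgroups are stable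
    under intersection. *)
Lemma least_overgroup J W' : J `<=` Pi -> parabolic J `<=` W' ->
  (exists U, finite_parabolic_overgroup B Pi J W' U) ->
  exists2 U0, finite_parabolic_overgroup B Pi J W' U0 &
    forall U, finite_parabolic_overgroup B Pi J W' U -> U0 `<=` U.
Proof.
move=> JPi JW' [U1 hU1]; pose H := parabolic J.
have HG : is_group H by apply: (parabolic_group Pi_based).
have exn : exists n, `[< exists U (l : seq (set (V -> V))), [/\
    finite_parabolic_overgroup B Pi J W' U, left_cosets U H `<=` [set` l] & size l = n] >].
  have [_ _ /finite_seqP[l lE]] := hU1; exists (size l); apply/asboolP.
  by exists U1, l; split=> //; rewrite -lE.
case: (ex_minnP exn) => _ /asboolP[U0 [l [hU0 lU <-]]] lmin.
exists U0 => // U hU u U0u; apply: contrapT => nUu.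
have [p0 W0 f0] := hU0; have [p1 W1 f1] := hU.
have hI : finite_parabolic_overgroup B Pi J W' (U0 `&` U).
  split; first exact: (parabolic_inter Pi_based).
    by move=> w W'w; split; [apply: W0|apply: W1].
  by apply: finite_index_sub f0 => ? [].
pose C := [set u \o h | h in H].
have Cl : C \in l by apply: lU; exists u.
have : (size l <= size (rem C l))%N.
  apply: lmin; apply/asboolP; exists (U0 `&` U), (rem C l); split=> // D DI.
  apply: rem_mem; last by apply: lU; case: DI => v [? _] <-; exists v.
  apply/eqP => DC; move: DI => [v [_ Uv] vD]; apply: nUu.
  have : C u by exists id => //; apply: group_id.
  rewrite -DC -vD => -[h Hh <-].
  have UG : is_group U.
    have [x [_ _ <-]] := parabolic_is_stab Pi_based p1; exact: stab_group.
  by apply: (group_comp UG Uv); apply: W1; apply: JW'.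
by rewrite size_rem //; case: (l) Cl => //= ? ? _; rewrite ltnn.
Qed.

End Averaging.

(** * Linear algebra and finite cardinals *)

Section LinearAlgebra.
Variable R : realFieldType.

Lemma wide_system n m (A : 'M[R]_(n, m)) : (m < n)%N ->
  exists2 v : 'rV[R]_n, v != 0 & v *m A = 0.
Proof.
move=> mn; have : kermx A != 0.
  by rewrite -mxrank_eq0 mxrank_ker subn_eq0 -ltnNge (leq_ltn_trans (rank_leq_col A)).
by move=> /rowV0Pn[v /sub_kermxP vA v0]; exists v.
Qed.

(** Coefficients of a linear relation with the Gram matrix of vectors that are
    pairwise at obtuse angles and lie strictly on one side of a hyperplane are
    non-positive. *)
Lemma obtuse_nonpos (I : finType) (T : eqType) (rs : seq T) (r0 : T)
    (a : I -> T -> R) (c : I -> R) : r0 \in rs ->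
  (forall k, 0 < a k r0) ->
  (forall k i, k != i -> \sum_(r <- rs) a k r * a i r <= 0) ->
  (forall k, \sum_i c i * \sum_(r <- rs) a k r * a i r = 0) ->
  forall k, c k <= 0.
Proof.
move=> r0rs a0 ob rel.
pose d k := Num.max (c k) 0; pose e k := Num.max (- c k) 0.
have d0 k : 0 <= d k by rewrite le_max lexx orbT.
have e0 k : 0 <= e k by rewrite le_max lexx orbT.
have de k : d k * e k = 0.
  rewrite /d /e; case: (lerP (c k) 0) => h; first by rewrite mul0r.
  by rewrite (_ : Num.max _ _ = 0) ?mulr0 //; apply/max_idPr; rewrite oppr_le0 ltW.
have dce k : d k = c k + e k.
  rewrite /d /e; case: (lerP (c k) 0) => h.
    by rewrite (max_idPl _) ?subrr // oppr_ge0.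
  by rewrite (max_idPr _) ?addr0 // oppr_le0 ltW.
have gram : \sum_(r <- rs) (\sum_k d k * a k r) ^+ 2 <= 0.
  have -> : \sum_(r <- rs) (\sum_k d k * a k r) ^+ 2 =
      \sum_k \sum_i d k * (d i * \sum_(r <- rs) a k r * a i r).
    under eq_bigr => r _ do rewrite expr2 big_distrlr /=.
    rewrite exchange_big; apply: eq_bigr => k _ /=; rewrite exchange_big.
    apply: eq_bigr => i _; rewrite !mulr_sumr; apply: eq_bigr => r _.
    by rewrite mulrACA -mulrA.
  apply: sumr_le0 => k _; rewrite -mulr_sumr.
  under eq_bigr => i _ do rewrite dce mulrDl.
  rewrite big_split /= rel add0r mulr_sumr; apply: sumr_le0 => i _; rewrite mulrA.
  have [<-|ki] := eqVneq k i; first by rewrite de mul0r.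
  by rewrite mulr_ge0_le0 ?ob // mulr_ge0.
have da0 : \sum_k d k * a k r0 = 0.
  apply/eqP; rewrite -sqrf_eq0 eq_le sqr_ge0 andbT; apply: le_trans gram.
  rewrite (big_rem r0) //= lerDl; apply: sumr_ge0 => r _; exact: sqr_ge0.
move=> k; have /psumr_eq0P/(_ da0 k isT)/eqP : forall i, true -> 0 <= d i * a i r0.
  by move=> i _; rewrite mulr_ge0 // ltW.
rewrite mulf_eq0 (gt_eqF (a0 k)) orbF => /eqP d0k.
by rewrite -d0k /d le_max lexx.
Qed.

End LinearAlgebra.

Section Cardinals.
Local Open Scope card_scope.

Lemma card_uniq_seq (X : choiceType) (s : seq X) : uniq s -> [set` s] #= `I_(size s).
Proof.
case: s => [_|x s us].
  by rewrite (_ : [set` [::]] = set0) /= ?II0 ?card_eq00 //; apply/seteqP; split.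
have -> : [set` x :: s] = nth x (x :: s) @` `I_(size (x :: s)).
  apply/seteqP; split=> [y /= ys|_ [i /= i_s <-]]; last by rewrite mem_nth.
  by exists (index y (x :: s)); [rewrite /mkset index_mem|rewrite nth_index].
apply: inj_card_eq => i j; rewrite !inE /= => i_s j_s /eqP.
by rewrite nth_uniq // => /eqP.
Qed.

Lemma finite_uniq_seq (X : choiceType) (A : set X) : finite_set A ->
  exists2 s : seq X, uniq s & A = [set` s].
Proof.
move=> /finite_seqP[s ->]; exists (undup s); first exact: undup_uniq.
by apply/seteqP; split=> x /=; rewrite mem_undup.
Qed.

End Cardinals.

(** * The least parabolic overgroup *)

Section Corank.
Variables (R : realType) (V : lmodType R) (B : {symmetric V}) (Pi : set V).
Hypothesis Pi_based : is_based_root_system B Pi.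

Local Notation W := (weyl_group B Pi).
Local Notation root := (root_system B Pi).
Local Notation pos := (cone Pi).
Local Notation rlinear := (rlinear B Pi).
Local Notation stab := (stab B Pi).
Local Notation almost_pos := (almost_pos B Pi).
Local Notation parabolic K := (standard_parabolic B K).
Local Notation T := (reflections B Pi).

Lemma stab_parabolic_sub x K : K `<=` Pi -> rlinear x ->
  (forall a, K a -> x a = 0) -> parabolic K `<=` stab x.
Proof.
move=> KPi hx xK; apply: generated_sub; first exact: (stab_group Pi_based).
move=> _ [a Ka <-]; apply/(stab_refl Pi_based) => //; last exact: xK.
by apply: (simple_root Pi_based); apply: KPi.
Qed.

(** The coordinate function of d in the free module on Pi *)
Lemma rlinear_coord (d : V) : exists e, rlinear e /\ forall a, Pi a -> e a = (a == d)%:R.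
Proof.
have [e he eE] := rlinear_ext Pi_based (fun a => (a == d)%:R).
by exists e.
Qed.

Variables (J : set V) (W' U0 : set (V -> V)) (g g' : V -> V) (K : set V).
Hypotheses (JPi : J `<=` Pi) (hW' : is_subgroup_of_W B Pi W').
Hypotheses (JW' : parabolic J `<=` W').
Hypothesis hU0 : finite_parabolic_overgroup B Pi J W' U0.
Hypothesis U0min : forall U, finite_parabolic_overgroup B Pi J W' U -> U0 `<=` U.
Hypotheses (Wg : W g) (Wg' : W g') (g1 : cancel g g') (g2 : cancel g' g).
Hypotheses (KPi : K `<=` Pi) (gJK : g @` J `<=` K).
Hypothesis U0E : U0 = conjugate g' (parabolic K).

(** The simple roots of the least overgroup outside those of J, up to
    conjugation by g *)
Let D := K `\` g @` J.

Lemma gJPi : g @` J `<=` Pi.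
Proof. by move=> b /gJK/KPi. Qed.

Lemma overgroup_group : is_group U0.
Proof.
by rewrite U0E; apply: (conjugate_group g2 g1); apply: (parabolic_group Pi_based).
Qed.

Lemma sub_overgroup : W' `<=` U0.
Proof. by case: hU0. Qed.

Lemma overgroup_simple a : K a -> U0 (reflection B (g' a)).
Proof.
move=> Ka; rewrite U0E; apply/(conjugateP _ _ g2 g1).
by rewrite (refl_conj Pi_based) // g2; exact: parabolic_mem.
Qed.

Lemma root_g'_simple a : K a -> root (g' a).
Proof.
by move=> Ka; apply: (weyl_root Pi_based Wg'); apply: (simple_root Pi_based); apply: KPi.
Qed.

(** A dominant function with zero set g J, precomposed with g, has stabiliser
    the standard parabolic subgroup of J. *)
Lemma stab_dominant_comp y : rlinear y -> (forall a, Pi a -> 0 <= y a) ->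
  (forall a, (g @` J) a <-> Pi a /\ y a = 0) -> stab (y \o g) = parabolic J.
Proof.
move=> hy yd yE; have e := stab_dominant Pi_based hy yd yE.
rewrite (stab_conj Pi_based _ Wg') (_ : _ \o g' = y); last first.
  by apply/funext => v /=; rewrite g2.
by rewrite e (parabolic_image Pi_based Wg JPi gJPi) (conjugateK _ g1 g2).
Qed.

Section Transversal.
Variable rs : seq (V -> V).
Hypothesis hrs : right_transversal W' (parabolic J) rs.

Lemma transversal_weyl r : r \in rs -> W r.
Proof. by case: hrs => _ h _ _ /h; case: hW' => _; apply. Qed.

(** By minimality, every orbit sum of a function with stabiliser the standard
    parabolic subgroup of J vanishes on the roots of the least overgroup. *)
Lemma orbit_sum_vanish y a : rlinear y -> (forall a, Pi a -> 0 <= y a) ->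
  (forall a, (g @` J) a <-> Pi a /\ y a = 0) -> K a ->
  orbit_sum (y \o g) rs (g' a) = 0.
Proof.
move=> hy yd yE Ka; have hyg := rlinear_weyl Pi_based Wg hy.
apply/(stab_refl Pi_based).
- by apply: (rlinear_orbit_sum Pi_based) => //; exact: transversal_weyl.
- exact: root_g'_simple.
apply: U0min; last exact: overgroup_simple.
apply: (stab_orbit_sum Pi_based) => //.
  by apply: (almost_pos_weyl Pi_based) => //; apply: (dominant_almost_pos Pi_based).
exact: stab_dominant_comp.
Qed.

Lemma simple_coset_finite : finite_set D.
Proof.
have [y [hy yd yE ys]] := parabolic_stab Pi_based gJPi.
have hyg := rlinear_weyl Pi_based Wg hy.
have ayg : almost_pos (y \o g).
  by apply: (almost_pos_weyl Pi_based) => //; apply: (dominant_almost_pos Pi_based).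
have [gW' W'W] := hW'.
have := finite_moved_roots Pi_based hrs W'W (group_id gW') hyg ayg.
move=> /(_ _)/wrap[h|fA].
  by rewrite -(stab_dominant_comp hy yd yE) => -[].
apply: (sub_finite_set _ (finite_image g fA)) => a [Ka nJ].
exists (g' a); rewrite ?g2 //; split=> /=.
- exact: root_g'_simple.
- exact: orbit_sum_vanish.
- by rewrite g2 => ya; apply: nJ; apply/yE; split=> //; apply: KPi.
Qed.

(** A reflection-linear function invariant under W' vanishes on the simple
    roots of the least parabolic overgroup, for otherwise a small multiple of
    it could be used to produce a smaller overgroup. *)
Lemma invariant_vanish q a : rlinear q -> W' `<=` stab q -> K a -> q (g' a) = 0.
Proof.
move=> hq qW' Ka; have [gW' W'W] := hW'.
have [y [hy yd yE ys]] := parabolic_stab Pi_based gJPi.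
have [f hf fE] := rlinear_ext Pi_based (fun v => if `[< K v >] then q (g' v) else 0).
have fK b : K b -> f b = q (g' b) by move=> Kb; rewrite fE ?asboolT //; apply: KPi.
have fN b : Pi b -> ~ K b -> f b = 0 by move=> Pb nK; rewrite fE // asboolF.
have [d dE] := (finite_seqP _).1 simple_coset_finite.
have y0 b : D b -> 0 < y b.
  move=> [Kb nJ]; rewrite lt_neqAle yd ?andbT; last exact: KPi.
  by apply/eqP => /esym yb; apply: nJ; apply/yE; split=> //; apply: KPi.
(* A scalar small enough for the perturbation to stay positive on D. *)
have [eps eps0 epsP] : exists2 eps : R, 0 < eps & forall b, D b -> 0 < eps * f b + y b.
  have : forall b, b \in d -> 0 < y b by move=> b bd; apply: y0; rewrite dE.
  rewrite dE; elim: {dE} d => [_|b d IHd h]; first by exists 1.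
  have [c cd|eps eps0 hd] := IHd; first by apply: h; rewrite inE cd orbT.
  have yb : 0 < y b by apply: h; rewrite mem_head.
  pose eta := y b / (`|f b| + 1).
  have f1 : 0 < `|f b| + 1 by rewrite ltr_wpDl.
  have eta0 : 0 < eta by rewrite divr_gt0.
  have eta_b t : 0 < t -> t <= eta -> 0 < t * f b + y b.
    move=> t0 te; rewrite -ltrBlDr sub0r; apply: lt_le_trans (_ : - (t * `|f b|) <= _).
      rewrite ltrN2; apply: le_lt_trans (_ : eta * `|f b| < _).
        by apply: ler_wpM2r.
      by rewrite /eta mulrAC ltr_pdivrMr // ltr_pM2l // ltrDl.
    rewrite -mulrN; apply: ler_wpM2l; first exact: ltW.
    exact: lerNnormlW.
  exists (Num.min eps eta); first by rewrite lt_min eps0.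
  move=> c; rewrite /= inE => /orP[/eqP->|cd].
    by apply: eta_b; rewrite ?lt_min ?eps0 // ge_min lexx orbT.
  have hc := hd _ cd; have yc : 0 < y c by apply: h; rewrite inE cd orbT.
  have m0 : 0 < Num.min eps eta by rewrite lt_min eps0.
  have [fc|fc] := lerP 0 (f c); first by rewrite ltr_wpDl // mulr_ge0 // ltW.
  apply: lt_le_trans hc _; rewrite lerD2r ler_nM2r //.
  by rewrite ge_min lexx.
pose y' v := eps * f v + y v.
have hy' : rlinear y' by apply: rlinear_lin.
have q0 b : J b -> q b = 0.
  move=> Jb; apply/(stab_refl Pi_based) => //.
    by apply: (simple_root Pi_based); apply: JPi.
  by apply: qW'; apply: JW'; exact: parabolic_mem.
have y'J b : (g @` J) b -> y' b = 0.
  move=> gJb; have [_ yb] := (yE b).1 gJb; have Kb := gJK gJb; case: gJb => c Jc cE.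
  by rewrite /y' yb fK // -cE g1 q0 // mulr0 addr0.
have y'D b : D b -> 0 < y' b by apply: epsP.
have y'N b : Pi b -> ~ K b -> y' b = y b by move=> Pb nK; rewrite /y' fN // mulr0 add0r.
have y'd b : Pi b -> 0 <= y' b.
  move=> Pb; have [Kb|nK] := pselect (K b); last by rewrite y'N // yd.
  have [Jb|nJ] := pselect ((g @` J) b); first by rewrite y'J.
  by rewrite ltW // y'D.
have y'E b : (g @` J) b <-> Pi b /\ y' b = 0.
  split=> [Jb|[Pb yb]]; first by split; [apply: gJPi|apply: y'J].
  have [Kb|nK] := pselect (K b); last by apply/yE; split=> //; rewrite -y'N.
  apply: contrapT => nJ; have : D b by [].
  by move=> /y'D; rewrite yb ltxx.
have := orbit_sum_vanish hy' y'd y'E Ka.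
have := orbit_sum_vanish hy yd yE Ka.
rewrite /orbit_sum /= => e; rewrite /y' big_split /= e addr0 -mulr_sumr.
(* On the orbit of g' a, the function f o g coincides with q. *)
have fq : forall b, K b -> forall k, parabolic K k -> f (k b) = q (g' (k b)).
  move=> b Kb k Kk.
  pose d' v := -1 * (q \o g') v + f v.
  have hd' : rlinear d' by apply: rlinear_lin => //; apply: (rlinear_weyl Pi_based).
  have d'K c : K c -> d' c = 0 by move=> Kc; rewrite /d' /= fK // mulN1r addNr.
  have [_ kd] := stab_parabolic_sub KPi hd' d'K Kk.
  have : d' (k b) = 0 by rewrite -[LHS]/((d' \o k) b) kd d'K.
  by rewrite /d' /= mulN1r addrC => /eqP; rewrite subr_eq0 => /eqP.
have [_ rsW' rsc _] := hrs.
rewrite (eq_big_seq (fun=> q (g' a))); last first.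
  move=> r rrs; have : U0 r by apply: sub_overgroup; apply: rsW'.
  rewrite U0E => /(conjugateP _ _ g2 g1) /(fq _ Ka); rewrite /= => ->.
  by rewrite g1 -[in RHS](qW' _ (rsW' _ rrs)).2.
rewrite big_const_seq count_predT iter_addr_0 => /eqP.
rewrite mulf_eq0 (gt_eqF eps0) /= mulrn_eq0 => /orP[|/eqP//].
have [r [h [rrs _ _]]] := rsc _ (group_id gW').
by case: (rs) rrs.
Qed.

(** * Lower bound for the corank *)

(** If every reflection-linear function fixed by U vanishes at the simple roots of
    the least overgroup, then at least as many reflections as there are elements
    in D are needed to generate U over the standard parabolic subgroup of J. *)
Lemma corank_lower U (T'' : set (V -> V)) : T'' `<=` T ->
  U = generated ((parabolic J `&` T) `|` T'') ->
  (forall q, rlinear q -> U `<=` stab q -> forall a, K a -> q (g' a) = 0) ->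
  (D #<= T'')%card.
Proof.
move=> T''T UE hU; have [d ud dE] := finite_uniq_seq simple_coset_finite.
have Dn : (D #= `I_(size d))%card by rewrite dE card_uniq_seq.
have [fT|iT] := pselect (finite_set T''); last first.
  apply: (card_le_trans (B := `I_(size d))); first by move: Dn; rewrite card_eq_le => /andP[].
  apply: card_le_trans ((infiniteP _).1 iT); exact: card_leT.
have [t ut tE] := finite_uniq_seq fT.
have Tm : (T'' #= `I_(size t))%card by rewrite tE card_uniq_seq.
rewrite (card_le_eql Dn) (card_le_eqr Tm) card_le_II leqNgt; apply/negP => mn.
have tP i : exists b, i \in t -> root b /\ reflection B b = i.
  have [it|_] := boolP (i \in t); last by exists 0.
  have : T'' i by rewrite tE.
  by move=> /T''T[b rb bi]; exists b.
have [b bE] := choice tP.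
have [e eE] := choice rlinear_coord.
pose A := \matrix_(k < size d, i < size t) e d`_k (g (b (nth id t i))).
have [v v0 vA] := wide_system A mn.
pose q u := \sum_(k <- index_enum 'I_(size d)) v 0 k * (e d`_k \o g) u.
have hq : rlinear q.
  by apply: rlinear_sum => k _; exact: (rlinear_weyl Pi_based Wg (eE d`_k).1).
have dD k : (k < size d)%N -> D d`_k by move=> kd; rewrite dE /= mem_nth.
have qJ a : J a -> q a = 0.
  move=> Ja; rewrite /q big1 // => k _ /=; case: (eE d`_k) => _ ->; last first.
    by apply: gJPi; exists a.
  case: eqP => [E|_]; last by rewrite mulr0.
  by case: (dD k (ltn_ord k)) => _; case; exists a.
have Uq : U `<=` stab q.
  rewrite UE; apply: generated_sub; first exact: (stab_group Pi_based).
  move=> h [[Jh _]|Th]; first exact: (stab_parabolic_sub JPi hq qJ).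
  have ht : h \in t by move: Th; rewrite tE.
  have [rb <-] := bE _ ht; apply/(stab_refl Pi_based) => //.
  have it : (index h t < size t)%N by rewrite index_mem.
  have := congr1 (fun z : 'rV_(size t) => z 0 (Ordinal it)) vA.
  rewrite !mxE => <-; apply: eq_bigr => k _; rewrite mxE /=.
  by rewrite nth_index.
case/eqP: v0; apply/rowP => k; rewrite mxE.
have [Kd nJ] := dD _ (ltn_ord k).
rewrite -(hU q hq Uq _ Kd) /q (bigD1 k) //= big1 => [|i ik].
  case: (eE d`_k) => _ ->; last by rewrite g2; apply: KPi.
  by rewrite g2 eqxx mulr1 addr0.
case: (eE d`_i) => _ ->; last by rewrite g2; apply: KPi.
by rewrite g2 nth_uniq // (inj_eq val_inj) eq_sym (negPf ik) mulr0.
Qed.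

(** * Generators of the least overgroup *)

Lemma overgroup_generators : exists T0,
  corank_generators B Pi U0 (parabolic J) T0 /\ (T0 #<= D)%card.
Proof.
pose T0 := (fun a => reflection B (g' a)) @` D.
have T0U : T0 `<=` U0 `&` T.
  move=> _ [a [Ka _] <-]; split; first exact: overgroup_simple.
  by exists (g' a) => //; exact: root_g'_simple.
exists T0; split; last exact: card_image_le.
split=> //; set X := _ `|` _.
have XU : X `<=` U0.
  move=> h [[Jh _]|/T0U[]//]; apply: sub_overgroup; exact: JW'.
have UG := overgroup_group; have XG := generated_group UG XU.
apply/seteqP; split; last exact: generated_sub.
rewrite U0E => h /(conjugateP _ _ g2 g1).
have cG : is_group (conjugate g (generated X)) by apply: conjugate_group g1 g2 XG.
have KX : parabolic K `<=` conjugate g (generated X).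
  apply: generated_sub => // _ [a Ka <-]; apply/(conjugateP _ _ g1 g2).
  rewrite -{1}[a]g2 -(refl_conj Pi_based _ Wg g2).
  rewrite (_ : _ \o g = reflection B (g' a)); last by apply/funext => v /=; rewrite !g1.
  apply: generated_mem; have [[j Jj ja]|nJ] := pselect ((g @` J) a).
    left; rewrite -ja g1; split; first exact: parabolic_mem.
    by exists j => //; apply: (simple_root Pi_based); apply: JPi.
  by right; exists a.
move=> /KX/(conjugateP _ _ g1 g2).
by rewrite (_ : _ \o g = h) //; apply/funext => v /=; rewrite !g1.
Qed.

(** * Upper bound for the corank *)

Section Generators.
Variable p : V -> R.
Hypotheses (hp : rlinear p) (ap : almost_pos p) (sp : stab p = parabolic J).

Let x := orbit_sum p rs.

Lemma fixed_by_J h : parabolic J h -> p \o h = p.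
Proof. by rewrite -sp => -[]. Qed.

Lemma rlinear_transversal r : r \in rs -> rlinear (p \o r).
Proof. by move=> rrs; apply: (rlinear_weyl Pi_based) => //; exact: transversal_weyl. Qed.

Lemma sub_weyl w : W' w -> W w.
Proof. by case: hW' => _; apply. Qed.

Lemma sub_stab_orbit_sum : W' `<=` stab x.
Proof.
move=> w W'w; split; first exact: sub_weyl.
have [gW' _] := hW'.
exact: (orbit_sum_inv gW' (parabolic_group Pi_based JPi) hrs fixed_by_J W'w).
Qed.

Lemma orbit_sum_root b : root b -> W' (reflection B b) -> x b = 0.
Proof.
move=> rb W'b; apply/(stab_refl Pi_based) => //; last exact: sub_stab_orbit_sum.
by apply: (rlinear_orbit_sum Pi_based) => //; exact: transversal_weyl.
Qed.

Lemma finite_roots_outside :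
  finite_set [set b | [/\ root b, W' (reflection B b) & p b <> 0]].
Proof.
have [gW' W'W] := hW'.
have := finite_moved_roots Pi_based hrs W'W (group_id gW') hp ap fixed_by_J.
apply: sub_finite_set => b [rb W'b pb]; split=> //; exact: orbit_sum_root.
Qed.

(** The identity represented in the transversal *)
Lemma transversal_id : exists2 r0, r0 \in rs & p \o r0 = p.
Proof.
have [gW' _] := hW'; have [_ _ rsc _] := hrs.
have [r [h [rrs Jh e]]] := rsc _ (group_id gW'); exists r => //.
by rewrite -{1}(fixed_by_J Jh) -compA -e.
Qed.

(** A positive semidefinite form invariant under W' *)
Definition gram b c := \sum_(r <- rs) p (r b) * p (r c).

Lemma gramC b c : gram b c = gram c b.
Proof. by apply: eq_bigr => r _; rewrite mulrC. Qed.

Lemma gram_inv w b c : W' w -> gram (w b) (w c) = gram b c.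
Proof.
move=> W'w; have [gW' _] := hW'.
apply: (transversal_perm (F := fun r => p (r b) * p (r c)) _ gW'
         (parabolic_group Pi_based JPi) hrs W'w).
by move=> h u /fixed_by_J e; rewrite -[X in X (u b) * X (u c)]e.
Qed.

Lemma gramNr b c : root c -> gram b (- c) = - gram b c.
Proof.
move=> rc; rewrite /gram -sumrN; apply: eq_big_seq => r /rlinear_transversal hr.
by rewrite -[p (r (- c))]/((p \o r) (- c)) (rlinearN Pi_based hr rc) mulrN.
Qed.

Lemma gram_refl b c : root b -> root c -> W' (reflection B c) ->
  gram b c = B b c * gram c c.
Proof.
move=> rb rc W'c; have := gram_inv b c W'c.
rewrite (refl_root Pi_based rc) gramNr //.
have -> : gram (reflection B c b) c = gram b c - 2 * B b c * gram c c.
  rewrite /gram mulr_sumr -sumrB; apply: eq_big_seq => r /rlinear_transversal[_ hr].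
  by rewrite -[p (r (reflection _ _ _))]/((p \o r) _) hr //=; ring.
by move=> h; lra.
Qed.

Lemma gram_gt0 b : p b <> 0 -> 0 < gram b b.
Proof.
move=> /eqP pb; have [r0 r0s pr0] := transversal_id.
rewrite /gram (big_rem r0) //= -[p (r0 b)]/((p \o r0) b) pr0 -expr2.
rewrite ltr_pwDl //; first by rewrite lt_neqAle sqr_ge0 eq_sym sqrf_eq0 pb.
by apply: sumr_ge0 => r _; rewrite -expr2 sqr_ge0.
Qed.

(** Two distinct roots of W' on the positive side of p do not generate an
    infinite dihedral group. *)
Lemma form_lt1 b c : root b -> root c -> W' (reflection B b) -> W' (reflection B c) ->
  0 < p b -> 0 < p c -> b <> c -> 0 < B b c -> B b c < 1.
Proof.
move=> rb rc W'b W'c pb pc bc Bbc.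
have gb : 0 < gram b b by apply: gram_gt0; apply/eqP; rewrite gt_eqF.
have ec := gram_refl rb rc W'c.
have eb := gram_refl rc rb W'b; rewrite gramC bilC in eb.
have e : gram b b = gram c c.
  by apply: (mulfI (_ : B b c != 0)); rewrite ?gt_eqF // -eb ec.
have sq : \sum_(r <- rs) (p (r b) - p (r c)) ^+ 2 = 2 * (1 - B b c) * gram b b.
  have -> : \sum_(r <- rs) (p (r b) - p (r c)) ^+ 2 = gram b b + gram c c - 2 * gram b c.
    rewrite /gram mulr_sumr -big_split -sumrB; apply: eq_bigr => r _ /=; ring.
  by rewrite eb -e; ring.
have le1 : B b c <= 1.
  have : 0 <= 2 * (1 - B b c) * gram b b.
    by rewrite -sq; apply: sumr_ge0 => r _; exact: sqr_ge0.
  by rewrite pmulr_lge0 // pmulr_rge0 // subr_ge0.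
rewrite lt_neqAle le1 andbT; apply/eqP => B1.
have pbc : p b = p c.
  have [r0 r0s pr0] := transversal_id.
  move: sq; rewrite B1 subrr mulr0 mul0r => /eqP.
  rewrite psumr_eq0 => [/allP/(_ r0 r0s)|r _]; last exact: sqr_ge0.
  rewrite sqrf_eq0 subr_eq0 => /eqP.
  by rewrite -[p (r0 b)]/((p \o r0) b) -[p (r0 c)]/((p \o r0) c) pr0.
(* The roots b + 2n (b - c) are infinitely many roots of W' on which p does not
   vanish. *)
pose s n := iter n (fun v => reflection B b (reflection B c v)) b.
have Bb1 := root_norm Pi_based rb; have Bc1 := root_norm Pi_based rc.
have sE n : s n = b + (n%:R * 2) *: (b - c).
  elim: n => [|n IHn]; first by rewrite mul0r scale0r addr0.
  rewrite /s iterS -/(s n) IHn !reflection1 // !(bilDl, bilZl, bilBl, bilNl).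
  rewrite (bilC B c b) B1 Bb1 Bc1.
  rewrite (_ : 2 * (1 + n%:R * 2 * (1 - 1)) = 2); last by ring.
  rewrite (_ : 2 * (1 + n%:R * 2 * (1 - 1) - 2 * 1) = - 2); last by ring.
  have -> : n.+1%:R * 2 = n%:R * 2 + 2 :> R by rewrite -addn1 natrD mulrDl mul1r.
  rewrite [in RHS]scalerDl [X in _ = _ + (_ + X)]scalerBr scaleNr opprK -!addrA.
  by congr (_ + (_ + _)); exact: addrC.
have wn n : exists2 w, W' w & s n = w b.
  have [gW' _] := hW'; elim: n => [|n [w W'w sw]]; first by exists id => //; apply: group_id.
  exists (reflection B b \o (reflection B c \o w)); last by rewrite /s iterS -/(s n) sw.
  by do 2?apply: (group_comp gW').
have sp0 n : root (s n) /\ p (s n) = p b.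
  have rs' m : root (s m).
    by have [w /sub_weyl Ww ->] := wn m; exact: (weyl_root Pi_based).
  split=> //; elim: n => // n IHn.
  have [_ pl] := hp.
  rewrite {1}/s iterS -/(s n) pl //; last first.
    by apply: (weyl_root Pi_based) => //; exact: (weyl_refl Pi_based).
  rewrite pl // IHn reflection1 // sE.
  rewrite !(bilDl, bilZl, bilBl, bilNl) (bilC B c b) B1 Bb1 Bc1 pbc; ring.
have sA n : [set b | [/\ root b, W' (reflection B b) & p b <> 0]] (s n).
  have [rsn psn] := sp0 n; split=> //.
    have [gW' _] := hW'; have [w W'w ->] := wn n; have [w' [W'w' w1 w2]] := group_inv gW' W'w.
    rewrite -(refl_conj Pi_based b (sub_weyl W'w) w2).
    by apply: (group_comp gW') => //; apply: (group_comp gW').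
  by rewrite psn; apply/eqP; rewrite gt_eqF.
have /finite_seqP[l lE] := finite_roots_outside.
rewrite lE in sA.
have : (size (map s (iota 0 (size l).+1)) <= size l)%N.
  apply: uniq_leq_size; last by move=> _ /mapP[n _ ->]; exact: sA.
  rewrite map_inj_in_uniq ?iota_uniq // => m n _ _.
  rewrite !sE => /addrI/eqP; rewrite -subr_eq0 -scalerBl scaler_eq0 subr_eq0.
  case/orP => [/eqP e2|]; last by rewrite subr_eq0 => /eqP.
  have : (m%:R : R) = n%:R by apply: (mulIf (_ : 2 != 0 :> R)); rewrite ?pnatr_eq0.
  by move/eqP; rewrite eqr_nat => /eqP.
by rewrite size_map size_iota ltnn.
Qed.

(** Subgroup generated by the reflections of the standard parabolic subgroup of
    J together with those in the members of S *)
Definition span_refl (S : seq V) :=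
  generated ((parabolic J `&` T) `|` [set reflection B b | b in [set` S]]).

Section SpanRefl.
Variable S : seq V.
Hypothesis SW' : forall b, b \in S -> W' (reflection B b).

Lemma span_refl_sub : span_refl S `<=` W'.
Proof.
have [gW' _] := hW'; apply: generated_sub => //.
by move=> h [[/JW']//|[b /= /SW' + <-]].
Qed.

Lemma span_refl_group : is_group (span_refl S).
Proof.
have [gW' _] := hW'; apply: (generated_group gW').
by move=> h [[/JW']//|[b /= /SW' + <-]].
Qed.

Lemma span_refl_J : parabolic J `<=` span_refl S.
Proof.
apply: generated_sub; first exact: span_refl_group.
move=> _ [a Ja <-]; apply: generated_mem; left; split; first exact: parabolic_mem.
by exists a => //; apply: (simple_root Pi_based); apply: JPi.
Qed.

Lemma span_refl_mem b : b \in S -> span_refl S (reflection B b).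
Proof. by move=> bS; apply: generated_mem; right; exists b. Qed.

End SpanRefl.

Hypothesis W'_refl : W' = generated (W' `&` T).

(** Generators of W' over the standard parabolic subgroup of J, chosen among
    the roots on the positive side of p so as to minimise the sum of the values
    of p. *)
Lemma minimal_generators : exists S : seq V,
  [/\ uniq S, forall b, b \in S -> [/\ root b, W' (reflection B b) & 0 < p b],
      W' `<=` span_refl S &
      forall S' : seq V, uniq S' ->
        (forall b, b \in S' -> [/\ root b, W' (reflection B b) & 0 < p b]) ->
        W' `<=` span_refl S' -> \sum_(b <- S) p b <= \sum_(b <- S') p b].
Proof.
have : finite_set [set b | [/\ root b, W' (reflection B b) & 0 < p b]].
  apply: sub_finite_set finite_roots_outside => b [rb W'b pb].
  by split=> //; apply/eqP; rewrite gt_eqF.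
move=> /finite_uniq_seq[L uL LE].
have LP b : b \in L <-> [/\ root b, W' (reflection B b) & 0 < p b].
  by have := congr1 (@^~ b) LE => /= ->.
have LW' : W' `<=` span_refl L.
  have LsW' b : b \in L -> W' (reflection B b) by move=> /LP[].
  rewrite {1}W'_refl; apply: generated_sub; first exact: span_refl_group.
  move=> t [W'b [b rb bE]]; rewrite -bE in W'b *.
  have [pb|pb|pb] := ltrgt0P (p b).
  - by apply: span_refl_mem; apply/LP.
  - rewrite -reflectionN; apply: span_refl_mem; apply/LP; rewrite reflectionN.
    rewrite (rlinearN Pi_based) // oppr_gt0; split=> //.
    exact: (opp_root Pi_based).
  - by apply: span_refl_J => //; rewrite -sp; apply/(stab_refl Pi_based).
pose P (m : (size L).-tuple bool) := `[< W' `<=` span_refl (mask m L) >].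
have Pt : P (nseq_tuple (size L) true) by apply/asboolP; rewrite mask_true.
case: (arg_minP (fun m : (size L).-tuple bool => \sum_(b <- mask m L) p b) Pt).
move=> m /asboolP mW' mmin; exists (mask m L); split=> //.
- exact: mask_uniq.
- by move=> b /mem_mask/LP.
move=> S' uS' S'L S'W'; pose m' := map_tuple (mem S') (in_tuple L).
have m'E : perm_eq (mask m' L) S'.
  apply: uniq_perm => //; first exact: mask_uniq.
  move=> b; rewrite /= -filter_mask mem_filter; apply/andP/idP => [[]//|bS'].
  by split=> //; apply/LP/S'L.
rewrite -(perm_big _ m'E); apply: mmin; apply/asboolP.
rewrite /span_refl (_ : [set` mask m' L] = [set` S']) //.
by apply/seteqP; split=> b /=; rewrite (perm_mem m'E).
Qed.

(** In a minimal set of generators, the roots and their images under the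
    parabolic subgroup of J are at obtuse angles: otherwise one of them could be
    replaced by a reflected root at which p is smaller. *)
Lemma minimal_obtuse (S : seq V) b c u : uniq S ->
  (forall b, b \in S -> [/\ root b, W' (reflection B b) & 0 < p b]) ->
  W' `<=` span_refl S ->
  (forall S' : seq V, uniq S' ->
     (forall b, b \in S' -> [/\ root b, W' (reflection B b) & 0 < p b]) ->
     W' `<=` span_refl S' -> \sum_(b <- S) p b <= \sum_(b <- S') p b) ->
  b \in S -> c \in S -> b != c -> parabolic J u -> B b (u c) <= 0.
Proof.
move=> uS SP SW' Smin; have [gW' _] := hW'.
wlog bc : b c u / p b <= p c.
  move=> wl bS cS bc Ju; case: (lerP (p b) (p c)) => [h|/ltW h]; first exact: wl.
  have [u' [Ju' u1 u2]] := group_inv (parabolic_group Pi_based JPi) Ju.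
  rewrite bilC -(u2 b) (weyl_isom Pi_based _ _ (parabolic_weyl Pi_based JPi Ju)).
  by apply: wl => //; rewrite eq_sym.
move=> bS cS b_c Ju; rewrite leNgt; apply/negP => k0.
have [rb W'b pb] := SP _ bS; have [rc W'c pc] := SP _ cS.
have W'u := JW' Ju; have Wu := sub_weyl W'u.
have [u' [Ju' u1 u2]] := group_inv (parabolic_group Pi_based JPi) Ju.
have ruc := weyl_root Pi_based Wu rc.
have puc : p (u c) = p c by rewrite -[RHS](congr1 (@^~ c) (fixed_by_J Ju)).
have W'uc : W' (reflection B (u c)).
  rewrite -(refl_conj Pi_based c Wu u2).
  by apply: (group_comp gW'); [apply: (group_comp gW')|apply: JW'].
set k := B b (u c) in k0.
pose e := reflection B b (u c).
have re : root e by apply: (weyl_root Pi_based) => //; apply: (weyl_refl Pi_based).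
have W'e : W' (reflection B e).
  have bK := refl_rootK Pi_based rb.
  rewrite -(refl_conj Pi_based (u c) (weyl_refl Pi_based rb) bK).
  by do 2?apply: (group_comp gW').
have pe : p e = p c - 2 * k * p b.
  by case: (hp) => _ h; rewrite /e h // puc /k bilC.
(* Any other generating set has a sum at least as large. *)
have key (S' : seq V) : uniq S' -> {subset rem c S <= S'} ->
    (forall b, b \in S' -> [/\ root b, W' (reflection B b) & 0 < p b]) ->
    span_refl S' (reflection B e) -> \sum_(b <- S) p b <= \sum_(b <- S') p b.
  move=> uS' sub S'P eS'; apply: Smin => //.
  have S'W' d : d \in S' -> W' (reflection B d) by move=> /S'P[].
  have GS' := span_refl_group S'W'.
  have bS' : span_refl S' (reflection B b) by apply: span_refl_mem; apply/sub/rem_mem.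
  have ucS' : span_refl S' (reflection B (u c)).
    have bK := refl_rootK Pi_based rb.
    rewrite -(bK (u c)) -/e -(refl_conj Pi_based e (weyl_refl Pi_based rb) bK).
    by do 2?apply: (group_comp GS').
  have Wu' := parabolic_weyl Pi_based JPi Ju'.
  have cS' : span_refl S' (reflection B c).
    rewrite -(u1 c) -(refl_conj Pi_based (u c) Wu' u1).
    have JS' := span_refl_J S'W'.
    by apply: (group_comp GS'); [apply: (group_comp GS') => //; apply: JS'|apply: JS'].
  apply: (subset_trans SW'); apply: generated_sub => // h [Jh|[d /= dS <-]].
    by apply: generated_mem; left.
  by have [->//|dc] := eqVneq d c; apply: span_refl_mem; apply/sub/rem_mem.
have sumS : \sum_(b <- S) p b = p c + \sum_(b <- rem c S) p b by rewrite (big_rem c).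
have remP d : d \in rem c S -> [/\ root d, W' (reflection B d) & 0 < p d].
  by move=> /mem_rem/SP.
have remW' d : d \in rem c S -> W' (reflection B d) by move=> /remP[].
have no_rem : ~ span_refl (rem c S) (reflection B e).
  move=> eS; have := key (rem c S) (rem_uniq _ uS) (fun=> id) remP eS.
  by rewrite sumS gerDr leNgt pc.
(* Of e and - e, the root at which p is positive replaces c. *)
have [e' e'e pe'] : exists2 e', (e' = e \/ e' = - e) & 0 < p e'.
  have [h|h|h] := ltrgt0P (p e); first by exists e => //; left.
    by exists (- e); [right|rewrite (rlinearN Pi_based) // oppr_gt0].
  case: no_rem; apply: span_refl_J => //.
  by rewrite -sp; apply/(stab_refl Pi_based).
have se' : reflection B e' = reflection B e by case: e'e => ->; rewrite ?reflectionN.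
have e'S : e' \notin rem c S.
  by apply/negP => h; apply: no_rem; rewrite -se'; apply: span_refl_mem.
have buc : b <> u c.
  move=> buc; have eN : e = - b by rewrite /e -buc (refl_root Pi_based).
  have e'b : e' = b.
    case: e'e pe' => ->; rewrite eN ?opprK // (rlinearN Pi_based) // oppr_gt0.
    by move=> /(lt_trans pb); rewrite ltxx.
  by move: e'S; rewrite e'b rem_mem.
have k1 : k < 1 by apply: form_lt1; rewrite ?puc.
have re' : root e' by case: e'e => -> //; apply: (opp_root Pi_based).
have : \sum_(b <- S) p b <= \sum_(b <- e' :: rem c S) p b.
  apply: key.
  - by rewrite /= e'S rem_uniq.
  - by move=> d; rewrite inE orbC => ->.
  - by move=> d; rewrite inE => /orP[/eqP->|/remP//]; rewrite se'.
  - by rewrite -se'; apply: generated_mem; right; exists e' => //=; rewrite mem_head.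
rewrite big_cons sumS lerD2r leNgt => /negP; apply.
have kpb : k * p b < p c by apply: lt_le_trans bc; rewrite gtr_pMl.
have kpb0 : 0 < k * p b by rewrite mulr_gt0.
by case: e'e => ->; rewrite ?(rlinearN Pi_based) // pe -mulrA; lra.
Qed.

(** Orbits of the standard parabolic subgroup of J on the roots of W' on which
    p does not vanish are finite. *)
Lemma finite_J_orbit b : exists s : seq V,
  [/\ root b, W' (reflection B b) & p b <> 0] ->
  uniq s /\ [set` s] = [set u b | u in parabolic J].
Proof.
have [[rb W'b pb]|nb] := pselect [/\ root b, W' (reflection B b) & p b <> 0]; last by exists [::].
have : finite_set [set u b | u in parabolic J].
  apply: sub_finite_set finite_roots_outside => _ [u Ju <-].
  have Wu := parabolic_weyl Pi_based JPi Ju; have [gW' _] := hW'.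
  have [u' [Ju' u1 u2]] := group_inv (parabolic_group Pi_based JPi) Ju.
  split; first exact: (weyl_root Pi_based).
    rewrite -(refl_conj Pi_based b Wu u2).
    by apply: (group_comp gW'); [apply: (group_comp gW') => //; apply: JW'|apply: JW'].
  by rewrite -[p (u b)]/((p \o u) b) fixed_by_J.
by move=> /finite_uniq_seq[s us sE]; exists s => _.
Qed.

(** The minimal generators are at most as many as the elements of D: otherwise
    there is a linear relation between them modulo J, which also holds between
    the averages of their orbits under the parabolic subgroup of J. These
    averages are orthogonal to J and at obtuse angles. *)
Lemma corank_upper : exists T0,
  corank_generators B Pi W' (parabolic J) T0 /\ (T0 #<= D)%card.
Proof.
have [gW' W'W] := hW'; have JG := parabolic_group Pi_based JPi.
have [S [uS SP SW' Smin]] := minimal_generators.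
have SrefW' b : b \in S -> W' (reflection B b) by move=> /SP[].
exists [set reflection B b | b in [set` S]]; split.
  split; first by move=> _ [b /= bS <-]; have [rb W'b _] := SP _ bS; split=> //; exists b.
  by apply/seteqP; split=> //; apply: span_refl_sub.
have [d ud dE] := finite_uniq_seq simple_coset_finite.
apply: card_le_trans (card_image_le _ _) _.
rewrite dE (card_le_eql (card_uniq_seq uS)) (card_le_eqr (card_uniq_seq ud)) card_le_II.
rewrite leqNgt; apply/negP => mn.
have [e eE] := choice rlinear_coord.
pose A := \matrix_(i < size S, k < size d) e d`_k (g S`_i).
have [c c0 cA] := wide_system A mn.
have dD k : (k < size d)%N -> D d`_k by move=> kd; rewrite dE /= mem_nth.
have SS (i : 'I_(size S)) : S`_i \in S by rewrite mem_nth.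
(* The relation given by c holds for all functions that vanish on J. *)
have rel q : rlinear q -> (forall a, J a -> q a = 0) -> \sum_i c 0 i * q S`_i = 0.
  move=> hq qJ.
  pose f v := -1 * (\sum_(k <- index_enum 'I_(size d)) q (g' d`_k) * e d`_k v) + (q \o g') v.
  have hf : rlinear f.
    apply: rlinear_lin; last exact: (rlinear_weyl Pi_based).
    by apply: rlinear_sum => k _; case: (eE d`_k).
  have fK a : K a -> f a = 0.
    move=> Ka; rewrite /f mulN1r /= addrC; apply/eqP; rewrite subr_eq0; apply/eqP.
    have Pa := KPi Ka.
    have [[j Jj ja]|nJ] := pselect ((g @` J) a).
      rewrite -ja g1 qJ // big1 // => k _; case: (eE d`_k) => _ ->; last by apply: gJPi; exists j.
      case: eqP => [E|_]; last by rewrite mulr0.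
      by case: (dD k (ltn_ord k)) => _; case; exists j.
    have ad : a \in d by have : D a by []; rewrite dE.
    have ia : (index a d < size d)%N by rewrite index_mem.
    rewrite (bigD1 (Ordinal ia)) //= big1 => [|k ka].
      by case: (eE d`_(index a d)) => _ -> //; rewrite nth_index // eqxx mulr1 addr0.
    case: (eE d`_k) => _ -> //; case: eqP => [ak|_]; last by rewrite mulr0.
    case/eqP: ka; apply: val_inj => /=.
    by rewrite ak index_uniq.
  have qS (i : 'I_(size S)) : q S`_i = \sum_(k < size d) q (g' d`_k) * A i k.
    have [rb W'b _] := SP _ (SS i); have rgb := weyl_root Pi_based Wg rb.
    have : f (g S`_i) = 0.
      apply/(stab_refl Pi_based hf rgb); apply: (stab_parabolic_sub KPi hf fK).
      have := sub_overgroup W'b; rewrite U0E => /(conjugateP _ _ g2 g1).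
      by rewrite (refl_conj Pi_based).
    rewrite /f /= g1 mulN1r addrC => /eqP; rewrite subr_eq0 => /eqP ->.
    by apply: eq_bigr => k _; rewrite mxE.
  under eq_bigr => i _ do rewrite qS mulr_sumr.
  rewrite exchange_big big1 // => k _ /=.
  have ck : \sum_i c 0 i * A i k = 0.
    by have := congr1 (fun z : 'rV_(size d) => z 0 k) cA; rewrite mxE [in RHS]mxE.
  under eq_bigr => i _ do rewrite mulrCA.
  by rewrite -mulr_sumr ck mulr0.
have [orb orbP] := choice finite_J_orbit.
have orbS b : b \in S -> uniq (orb b) /\ [set` orb b] = [set u b | u in parabolic J].
  by move=> /SP[rb W'b pb]; apply: orbP; split=> //; apply/eqP; rewrite gt_eqF.
have orb_mem b v : b \in S -> v \in orb b -> exists2 u, parabolic J u & v = u b.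
  move=> /orbS[_ oE] vb; have : [set` orb b] v by [].
  by rewrite oE => -[u Ju <-]; exists u.
have mem_orb b u : b \in S -> parabolic J u -> u b \in orb b.
  move=> /orbS[_ oE] Ju; suff : [set` orb b] (u b) by [].
  by rewrite oE; exists u.
have orb_root b v : b \in S -> v \in orb b -> root v.
  move=> bS /(orb_mem _ _ bS)[u Ju ->]; have [rb _ _] := SP _ bS.
  exact: (weyl_root Pi_based (parabolic_weyl Pi_based JPi Ju)).
have orb_gt0 b : b \in S -> 0 < (size (orb b))%:R :> R.
  move=> bS; rewrite ltr0n; have := mem_orb b id bS (group_id JG).
  by case: (orb b).
(* Values at the functions of the orbit of p of the average of the orbit of b,
   and the form defined by that average *)
pose avg b r : R := (\sum_(v <- orb b) p (r v)) / (size (orb b))%:R.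
pose q b v := \sum_(r <- rs) avg b r * (p \o r) v.
have hq b : rlinear (q b) by apply: rlinear_sum => r /rlinear_transversal.
have qgram b v : q b v = (\sum_(w <- orb b) gram w v) / (size (orb b))%:R.
  rewrite exchange_big /= mulr_suml; apply: eq_bigr => r _.
  by rewrite /avg -mulr_suml mulrAC.
have qJ b a : b \in S -> J a -> q b a = 0.
  move=> bS Ja; rewrite qgram; have [ub _] := orbS _ bS.
  have ra := simple_root Pi_based (JPi Ja); have sK := refl_rootK Pi_based ra.
  have Jsa : parabolic J (reflection B a) by exact: parabolic_mem.
  have us : uniq (map (reflection B a) (orb b)).
    by rewrite map_inj_uniq //; apply: can_inj sK.
  have ss : {subset map (reflection B a) (orb b) <= orb b}.
    move=> _ /mapP[v /(orb_mem _ _ bS)[u Ju ->] ->].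
    by apply: (mem_orb b (reflection B a \o u)) => //; apply: (group_comp JG).
  have [_ ms] := uniq_min_size us ss (eq_leq (esym (size_map _ _))).
  have e1 : \sum_(w <- orb b) gram w a = - \sum_(w <- orb b) gram w a.
    rewrite -[LHS](perm_big _ (uniq_perm us ub ms)) big_map -sumrN.
    apply: eq_bigr => v _; rewrite -(gram_inv _ _ (JW' Jsa)) sK.
    by rewrite (refl_root Pi_based ra) gramNr.
  by rewrite (_ : \sum_(w <- _) _ = 0) ?mul0r //; lra.
have q_orb b v : b \in S -> forall u, parabolic J u -> q b (u v) = q b v.
  move=> bS u Ju; have [_ h] := stab_parabolic_sub JPi (hq b) (qJ b ^~ bS) Ju.
  by rewrite -[LHS]/((q b \o u) v) h.
have avgq b b' : b \in S -> b' \in S -> \sum_(r <- rs) avg b r * avg b' r = q b b'.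
  move=> bS b'S.
  have -> : \sum_(r <- rs) avg b r * avg b' r =
      (\sum_(v <- orb b') q b v) / (size (orb b'))%:R.
    rewrite exchange_big /= mulr_suml; apply: eq_bigr => r _.
    by rewrite {2}/avg mulrA mulr_sumr.
  rewrite (eq_big_seq (fun=> q b b')) => [|v /(orb_mem _ _ b'S)[u Ju ->]]; last exact: q_orb.
  rewrite big_const_seq count_predT iter_addr_0 -[q b b' *+ _]mulr_natr mulfK //.
  by rewrite gt_eqF // orb_gt0.
have [r0 r0s pr0] := transversal_id.
have nonpos (c' : 'I_(size S) -> R) : (forall k : 'I_(size S), \sum_i c' i * q S`_k S`_i = 0) ->
    forall k, c' k <= 0.
  move=> c'E; apply: (@obtuse_nonpos _ _ _ rs r0 (fun i : 'I_(size S) => avg S`_i)) => //.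
  - move=> k; have [_ _ pk] := SP _ (SS k).
    rewrite /avg (eq_big_seq (fun=> p S`_k)) => [|v /(orb_mem _ _ (SS k))[u Ju ->]].
      rewrite big_const_seq count_predT iter_addr_0 -[p _ *+ _]mulr_natr mulfK //.
      by rewrite gt_eqF // orb_gt0.
    by rewrite -[LHS]/((p \o r0) (u S`_k)) pr0 -[LHS]/((p \o u) S`_k) fixed_by_J.
  - move=> k i ki; rewrite avgq // qgram.
    apply: mulr_le0_ge0; last by rewrite invr_ge0 ler0n.
    rewrite big_seq; apply: sumr_le0 => v vk; have rv := orb_root _ _ (SS k) vk.
    have [ri W'i pi0] := SP _ (SS i).
    rewrite gram_refl //; apply: mulr_le0_ge0; last first.
      by apply: ltW; apply: gram_gt0; apply/eqP; rewrite gt_eqF.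
    have [u Ju ->] := orb_mem _ _ (SS k) vk.
    rewrite bilC; apply: (minimal_obtuse uS SP) => //.
    by rewrite nth_uniq // (inj_eq val_inj) eq_sym.
  - by move=> k; rewrite -[RHS](c'E k); apply: eq_bigr => i _; rewrite avgq.
have cle k : c 0 k <= 0.
  by move: k; apply: nonpos => k; apply: rel => // a; apply: qJ.
have cge k : - c 0 k <= 0.
  move: k; apply: nonpos => k; under eq_bigr => i _ do rewrite mulNr.
  by rewrite sumrN rel ?oppr0 // => a; apply: qJ.
case/eqP: c0; apply/rowP => k; rewrite mxE; apply/le_anti.
by rewrite cle -oppr_le0 cge.
Qed.

End Generators.
(** Both coranks are the number of simple roots in K outside g J. *)
Lemma corank_overgroup : W' = generated (W' `&` T) ->
  exists C, has_corank B Pi U0 (parabolic J) C /\ has_corank B Pi W' (parabolic J) C.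
Proof.
move=> W'E; have [p [hp pd _ sp]] := parabolic_stab Pi_based JPi.
have ap := dominant_almost_pos Pi_based hp pd.
have [T0 [gT0 T0D]] := overgroup_generators.
have [T1 [gT1 T1D]] := corank_upper hp ap sp W'E.
have lowU0 T2 : corank_generators B Pi U0 (parabolic J) T2 -> (D #<= T2)%card.
  move=> [T2U UT2]; apply: (corank_lower _ UT2) => [t /T2U[]//|q hq U0q a Ka].
  apply/(stab_refl Pi_based hq (root_g'_simple Ka)).
  by apply: U0q; exact: overgroup_simple.
have lowW' T2 : corank_generators B Pi W' (parabolic J) T2 -> (D #<= T2)%card.
  move=> [T2U UT2]; apply: (corank_lower _ UT2) => [t /T2U[]//|q hq W'q a Ka].
  exact: invariant_vanish.
exists T0; split.
- by exists T0; split=> // T2 /lowU0; exact: card_le_trans.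
- exists T1; split=> // [T2 /lowW'|]; first exact: card_le_trans.
  by rewrite card_eq_le (card_le_trans T1D (lowU0 _ gT0)) (card_le_trans T0D (lowW' _ gT1)).
Qed.

End Transversal.
End Corank.

Theorem theorem1p43 (R : realType) (V : lmodType R) (B : {symmetric V})
    (Pi : set V) (J : set V) (W' : set (V -> V))
    (Pi_based : is_based_root_system B Pi)
    (J_sub : J `<=` Pi)
    (W'_sub : is_subgroup_of_W B Pi W')
    (WJ_sub : standard_parabolic B J `<=` W') :
  [/\ finite_index W' (standard_parabolic B J)
        <-> exists U, finite_parabolic_overgroup B Pi J W' U,
      (exists U, finite_parabolic_overgroup B Pi J W' U)
        <-> exists (w : V -> V) (K : set V),
              [/\ weyl_group B Pi w, K `<=` Pi, w @` J `<=` K,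
                  finite_index (standard_parabolic B K)
                    (standard_parabolic B (w @` J))
                & [/\ standard_parabolic B (w @` J)
                        = conjugate w (standard_parabolic B J),
                      conjugate w (standard_parabolic B J)
                        `<=` conjugate w W'
                    & conjugate w W' `<=` standard_parabolic B K]]
    & finite_index W' (standard_parabolic B J) ->
      exists U0 : set (V -> V),
        [/\ inclusion_minimal (finite_parabolic_overgroup B Pi J W') U0,
            forall U, inclusion_minimal
              (finite_parabolic_overgroup B Pi J W') U -> U = U0
          & is_reflection_subgroup B Pi W' ->
            exists C : set (V -> V),
              has_corank B Pi U0 (standard_parabolic B J) C /\
              has_corank B Pi W' (standard_parabolic B J) C]].
Proof.
have over : finite_index W' (standard_parabolic B J) ->
    exists U, finite_parabolic_overgroup B Pi J W' U by exact: finite_overgroup.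
split.
- split=> // -[U [_ W'U]]; exact: finite_index_sub.
- split=> [[U [parU W'U fin]]|[w [K [Ww KPi wJK fin [WL _ W'K]]]]].
    have JU := subset_trans WJ_sub W'U.
    have [g [g' [K [Wg Wg' g1 g2 [KPi gJK UE]]]]] :=
      parabolic_overgroup Pi_based J_sub parU JU.
    have JE := parabolic_image Pi_based Wg J_sub (subset_trans gJK KPi).
    have KE : standard_parabolic B K = conjugate g U by rewrite UE (conjugateK _ g2 g1).
    exists g, K; split=> //; first by rewrite JE KE; apply: finite_index_conj g1 g2 fin.
    by split=> //; [apply: conjugate_sub|rewrite KE; apply: conjugate_sub].
  have [w' [Ww' w1 w2]] := weyl_inv Pi_based Ww.
  exists (conjugate w' (standard_parabolic B K)); split; first by exists w', K.
    move=> h W'h; apply/(conjugateP _ _ w2 w1); apply: W'K.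
    apply/(conjugateP _ _ w1 w2).
    by rewrite (_ : _ \o w = h) //; apply/funext => v /=; rewrite !w1.
  rewrite -[standard_parabolic B J](conjugateK _ w1 w2) -WL.
  exact: finite_index_conj w2 w1 fin.
move=> fin; have [U0 hU0 U0min] := least_overgroup Pi_based J_sub WJ_sub (over fin).
exists U0; split.
- by split=> // U hU UU0; apply/seteqP; split=> //; apply: U0min.
- by move=> U [hU /(_ _ hU0 (U0min _ hU))].
move=> [_ W'E]; have [parU0 W'U0 finU0] := hU0.
have [g [g' [K [Wg Wg' g1 g2 [KPi gJK UE]]]]] :=
  parabolic_overgroup Pi_based J_sub parU0 (subset_trans WJ_sub W'U0).
have JG := parabolic_group Pi_based J_sub.
have [rs hrs] := right_transversal_exists (proj1 W'_sub) JG WJ_sub fin.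
exact: (corank_overgroup Pi_based J_sub W'_sub WJ_sub hU0 U0min Wg Wg' g1 g2 KPi gJK UE hrs W'E).
Qed.
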